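(* (a) Let $U_\hbar(\mathfrak g)$ be a QUEA, and let $U_\hbar(\mathfrak g)'$ be its associated QFSHA. Let $\sigma:=\exp_*(\hbar^{-1}\chi)$ be a polar 2-cocycle for $U_\hbar(\mathfrak g)$. Then the restriction $\sigma\big|_{U_\hbar(\mathfrak g)'\times U_\hbar(\mathfrak g)'}$ of $\sigma$ to $U_\hbar(\mathfrak g)'\times U_\hbar(\mathfrak g)'$ is a well-defined, $\Bbbk[[\hbar]]$-valued bilinear form on $U_\hbar(\mathfrak g)'$, of the form $\sigma'=\exp_*(\hbar^{+1}\chi')$ with $\chi':=(\hbar^{-2}\chi)\big|_{U_\hbar(\mathfrak g)'\times U_\hbar(\mathfrak g)'}$, and this $\sigma':=\exp_*(\hbar^{+1}\chi')$ is a 2-cocycle for $U_\hbar(\mathfrak g)'$. (b) Let $F_\hbar[[G]]$ be a QFSHA, and let $F_\hbar[[G]]^\vee$ be its associated QUEA. Let $\mathcal F:=\exp(\hbar^{-1}\phi)$ be a polar twist for $F_\hbar[[G]]$. Then $\mathcal F:=\exp(\hbar^{-1}\phi)=\exp(\hbar^{+1}\phi^\vee)$ with $\phi^\vee:=\hbar^{-2}\phi\in(F_\hbar[[G]]^\vee)^{\widehat\otimes2}$, and, in these terms, $\mathcal F^\vee:=\exp(\hbar^{+1}\phi^\vee)$ is a twist for $F_\hbar[[G]]^\vee$.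
   Context: $\Bbbk$ is a field of characteristic $0$. $\widehat\otimes$ is the $\hbar$-adically completed tensor product of topologically free $\Bbbk[[\hbar]]$-modules (those $\cong V[[\hbar]]$). For topological modules $\cong\Bbbk[[\hbar]]^{E}$ with the weak topology, $\widetilde\otimes$ is the completed tensor product with $\Bbbk[[\hbar]]^{E_1}\widetilde\otimes\,\Bbbk[[\hbar]]^{E_2}\cong\Bbbk[[\hbar]]^{E_1\times E_2}$. Sweedler notation $\Delta(x)=x_{(1)}\otimes x_{(2)}$ is used. QUEA: a topologically free topological Hopf algebra $U_\hbar=U_\hbar(\mathfrak g)$ (for $\widehat\otimes$) with $U_\hbar/\hbar U_\hbar\cong U(\mathfrak g)$ as Hopf algebras for a Lie algebra $\mathfrak g$. QFSHA: a topological Hopf algebra $F_\hbar=F_\hbar[[G]]$ of type $\Bbbk[[\hbar]]^E$ (for $\widetilde\otimes$) with $F_\hbar/\hbar F_\hbar$ commutative and complete in the adic topology of its augmentation ideal, i.e. $\cong F[[G]]$ for a formal group $G$. $\mathfrak g$ and $G$ are finite-dimensional here. Drinfeld functors: $U_\hbar(\mathfrak g)':=\{\eta\in U_\hbar(\mathfrak g)\mid\delta_n(\eta)\in\hbar^nU_\hbar(\mathfrak g)^{\widehat\otimes n}\ \forall n\ge0\}$ with $\delta_n=(\mathrm{id}-\iota\circ\epsilon)^{\otimes n}\circ\Delta^{(n-1)}$ ($\iota$ the unit map), which is a QFSHA; $F_\hbar[[G]]^\vee$ is the $\hbar$-adic completion of $\sum_{n\ge0}\hbar^{-n}I^n$,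 $I=\hbar F_\hbar[[G]]+\mathrm{Ker}(\epsilon)$, which is a QUEA. 2-cocycle for $H$: a convolution invertible bilinear form with $\sigma(a,1)=\epsilon(a)=\sigma(1,a)$ and $\sigma(a_{(1)},b_{(1)})\sigma(a_{(2)}b_{(2)},c)=\sigma(b_{(1)},c_{(1)})\sigma(a,b_{(2)}c_{(2)})$; convolution is $(\alpha*\beta)(a,b)=\alpha(a_{(1)},b_{(1)})\beta(a_{(2)},b_{(2)})$, with exponential $\exp_*$. Twist for $H$: an invertible $\mathcal F\in H\otimes H$ (completed) with $(\epsilon\otimes\mathrm{id})(\mathcal F)=1=(\mathrm{id}\otimes\epsilon)(\mathcal F)$ and $\mathcal F_{12}(\Delta\otimes\mathrm{id})(\mathcal F)=\mathcal F_{23}(\mathrm{id}\otimes\Delta)(\mathcal F)$. Polar 2-cocycle of $U=U_\hbar(\mathfrak g)$: a $\Bbbk((\hbar))$-bilinear form on $\mathbb U:=\Bbbk((\hbar))\otimes_{\Bbbk[[\hbar]]}U$ of the form $\sigma=\exp_*(\hbar^{-1}\chi)=\sum_{n\ge0}\hbar^{-n}\chi^{*n}/n!$, where $\chi\in(U^{\widehat\otimes2})^*$ is a $\Bbbk[[\hbar]]$-bilinear form on $U$ (extended by scalars to $\mathbb U$) with $\chi(z,1)=0=\chi(1,z)$ for all $z\in U$, and which enjoys the 2-cocycle properties with respect to the ''Hopf algebra structure'' of $\mathbb U$ induced by scalar extension from $U$ (coproduct with values in $\Bbbk((\hbar))\otimes_{\Bbbk[[\hbar]]}(U\widehat\otimes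 U)$). Polar twist of $F_\hbar[[G]]$: an element $\mathcal F=\exp(\hbar^{-1}\phi)\in(F_\hbar[[G]]^\vee)^{\widehat\otimes2}$, with $\phi\in F_\hbar[[G]]^{\widetilde\otimes2}$ and $(\mathrm{id}\otimes\epsilon)(\phi)=0=(\epsilon\otimes\mathrm{id})(\phi)$, having the property of a twist for $F_\hbar[[G]]^\vee$. *)

(* Defs.v *)
From HB Require Import structures.
From mathcomp Require Import all_boot all_algebra.
From mathcomp Require Import finmap boolp classical_sets functions cardinality.
From mathcomp Require Import fsbigop.

Set Implicit Arguments.
Unset Strict Implicit.
Unset Printing Implicit Defensive.

Import GRing.Theory.
Local Open Scope ring_scope.
Local Open Scope classical_set_scope.

Record fps (k : Type) := Fps { fcoef : nat -> k }.

HB.instance Definition _ (k : Type) := gen_eqMixin (fps k).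
HB.instance Definition _ (k : Type) := gen_choiceMixin (fps k).

Section PowerSeries.
Variable k : fieldType.
Implicit Types f g : fps k.

Lemma fpsP f g : fcoef f =1 fcoef g <-> f = g.
Proof.
split=> [|-> //]; case: f g => [f] [g] /= fg.
by congr Fps; apply: funext.
Qed.

Definition fps_zero : fps k := Fps (fun=> 0).
Definition fps_one : fps k := Fps (fun n => (n == 0%N)%:R).
Definition fps_opp f : fps k := Fps (fun n => - fcoef f n).
Definition fps_add f g : fps k := Fps (fun n => fcoef f n + fcoef g n).
Definition fps_mul f g : fps k :=
  Fps (fun n => \sum_(i < n.+1) fcoef f i * fcoef g (n - i)%N).

Fact fps_addA : associative fps_add.
Proof. by move=> f g l; apply/fpsP => n /=; rewrite addrA. Qed.
Fact fps_addC : commutative fps_add.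
Proof. by move=> f g; apply/fpsP => n /=; rewrite addrC. Qed.
Fact fps_add0 : left_id fps_zero fps_add.
Proof. by move=> f; apply/fpsP => n /=; rewrite add0r. Qed.
Fact fps_addN : left_inverse fps_zero fps_opp fps_add.
Proof. by move=> f; apply/fpsP => n /=; rewrite addNr. Qed.

HB.instance Definition _ := GRing.isZmodule.Build (fps k)
  fps_addA fps_addC fps_add0 fps_addN.

Let tr N f : {poly k} := \poly_(i < N.+1) fcoef f i.

Let tr_coef N f n : (n <= N)%N -> (tr N f)`_n = fcoef f n.
Proof. by move=> nN; rewrite coef_poly ltnS nN. Qed.

Let mul_tr N f g n : (n <= N)%N ->
  fcoef (fps_mul f g) n = (tr N f * tr N g)`_n.
Proof.
move=> nN; rewrite coefM /=; apply: eq_bigr => i _.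
by rewrite !tr_coef ?(leq_trans (leq_subr _ _))// (leq_trans _ nN)// -ltnS.
Qed.

Fact fps_mulC : commutative fps_mul.
Proof. by move=> f g; apply/fpsP => n; rewrite !(mul_tr _ _ (leqnn n)) mulrC. Qed.

Fact fps_mulA : associative fps_mul.
Proof.
move=> f g l; apply/fpsP => n.
have -> : fcoef (fps_mul f (fps_mul g l)) n = (tr n f * (tr n g * tr n l))`_n.
  rewrite coefM; apply: eq_bigr => -[i ltin] _ /=; congr (_ * _).
    by rewrite [RHS]tr_coef.
  by rewrite -mul_tr ?leq_subr.
rewrite mulrA coefM; apply: eq_bigr => -[i ltin] _ /=; congr (_ * _).
  by rewrite -mul_tr.
by rewrite [LHS]tr_coef ?leq_subr.
Qed.

Fact fps_mul1 : left_id fps_one fps_mul.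
Proof.
move=> f; apply/fpsP => n /=; rewrite big_ord_recl /= mul1r subn0.
by rewrite big1 ?addr0// => i _; rewrite mul0r.
Qed.

Fact fps_mulDl : left_distributive fps_mul fps_add.
Proof.
move=> f g l; apply/fpsP => n /=; rewrite -big_split.
by apply: eq_bigr => i _; rewrite mulrDl.
Qed.

Fact fps_one_neq0 : fps_one != 0.
Proof.
apply/eqP => /fpsP /(_ 0%N) /= /eqP.
by rewrite oner_eq0.
Qed.

HB.instance Definition _ := GRing.Zmodule_isComNzRing.Build (fps k)
  fps_mulA fps_mulC fps_mul1 fps_mulDl fps_one_neq0.

Fixpoint fps_inv_seq f n : seq k :=
  if n is m.+1 then
    let s := fps_inv_seq f m in
    rcons s ((fcoef f 0)^-1 *
      ((m == 0)%:R - \sum_(i < m) s`_i * fcoef f (m - i)%N))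
  else [::].

Definition fps_unit : pred (fps k) := fun f => fcoef f 0 != 0.
Definition fps_inv f : fps k :=
  if fps_unit f then Fps (fun n => (fps_inv_seq f n.+1)`_n) else f.

Let size_inv_seq f n : size (fps_inv_seq f n) = n.
Proof. by elim: n => //= n IHn; rewrite size_rcons IHn. Qed.

Let nth_inv_seq f n i : (i < n)%N ->
  (fps_inv_seq f n)`_i = (fps_inv_seq f i.+1)`_i.
Proof.
elim: n => // n IHn; rewrite ltnS leq_eqVlt => /predU1P[-> //|lt_in].
by rewrite -IHn //= nth_rcons size_inv_seq lt_in.
Qed.

Fact fps_mulVr : {in fps_unit, left_inverse 1 fps_inv *%R}.
Proof.
move=> f uf; apply/fpsP => n.
have {}uf : fps_unit f by [].
rewrite -[_ * _]/(fps_mul _ _) /fps_inv uf /= big_ord_recr /= subnn.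
rewrite nth_rcons size_inv_seq ltnn eqxx mulrAC mulVf// mul1r.
under eq_bigr => i _ do rewrite -[rcons _ _]/(fps_inv_seq f i.+1)
  -(@nth_inv_seq f n i)//.
by rewrite addrC subrK.
Qed.

Fact fps_unitP f g : g * f = 1 -> f \in fps_unit.
Proof.
move=> /fpsP /(_ 0%N); rewrite /= big_ord1 subnn => gf.
by apply/eqP => f0; move/eqP: gf; rewrite f0 mulr0 eq_sym oner_eq0.
Qed.

Fact fps_inv0id : {in [predC fps_unit], fps_inv =1 id}.
Proof.
by move=> f uf; rewrite /fps_inv; have /negbTE -> : ~~ fps_unit f by [].
Qed.

HB.instance Definition _ := GRing.ComNzRing_hasMulInverse.Build (fps k)
  fps_mulVr fps_unitP fps_inv0id.

Fact fps_idomain : GRing.integral_domain_axiom (fps k).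
Proof.
move=> f g fg0; apply/norP => -[f0 g0].
have low l : l != 0 -> exists n, (fcoef l n != 0) /\
    forall m, (m < n)%N -> fcoef l m = 0.
  move=> l0; have ex : exists n, fcoef l n != 0.
    apply: contrapT => /forallNP l_0; move/eqP: l0; apply.
    by apply/fpsP => n; apply/eqP/negPn/negP/l_0.
  case: (ex_minnP ex) => n ln min; exists n; split=> // m mn.
  by apply/eqP/negPn/negP => /min; rewrite leqNgt mn.
have [a [fa fm]] := low f f0; have [b [gb gm]] := low g g0.
have /fpsP/(_ (a + b)%N) /= := fg0.
have alt : (a < (a + b).+1)%N by rewrite ltnS leq_addr.
rewrite (bigD1 (Ordinal alt))//= addKn big1 ?addr0.
  by move/eqP; rewrite mulf_eq0 (negbTE fa) (negbTE gb).
move=> i ia; have [lt_ia|le_ai] := ltnP i a; first by rewrite fm// mul0r.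
have lt_ai : (a < i)%N by rewrite ltn_neqAle le_ai andbT eq_sym; exact: ia.
rewrite gm ?mulr0// ltn_subLR; last by rewrite -ltnS.
by rewrite ltn_add2r.
Qed.

HB.instance Definition _ := GRing.ComUnitRing_isIntegral.Build (fps k)
  fps_idomain.

Definition hbar : fps k := Fps (fun n => (n == 1%N)%:R).

End PowerSeries.

Arguments hbar {k}.

Notation laurent k := {fraction (fps k)}.

(** A topologically free module V[[h]], with B a basis of V, is the module of
    the families [x : B -> k[[h]]] that tend to 0 h-adically ([null]); its
    completed tensor product with the module of basis C is the one of basis
    [B * C].  A module k[[h]]^E consists of all the families indexed by E, and
    again E1, E2 give [E1 * E2].  In both cases a continuous linear map is
    given by the matrix M of the images [M i] of the topological basis, and
    sends x to [sum_i x i *: M i]; a continuous linear form is a family of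
    scalars. *)

Variant top_kind := TopFree | TopProd.

Section Modules.
Variable k : fieldType.
Local Notation K := (fps k).
Local Notation L := (laurent k).
Local Notation "x %:F" := (tofrac x).

Definition hdvd (n : nat) (f : K) : Prop := exists g, f = hbar ^+ n * g.

Definition hdvdv (I : Type) (n : nat) (x : I -> K) : Prop :=
  forall i, hdvd n (x i).

Definition null (I : Type) (x : I -> K) : Prop :=
  forall n, finite_set [set i | ~ hdvd n (x i)].

(* Each coefficient is a finite sum as soon as [x] is null. *)
Definition ssum (I : choiceType) (x : I -> K) : K :=
  Fps (fun n => \sum_(i \in [set: I]) fcoef (x i) n).

Definition vec (t : top_kind) (I : Type) (x : I -> K) : Prop :=
  if t is TopFree then null x else True.

Definition lmor (t : top_kind) (I J : Type) (M : I -> J -> K) : Prop :=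
  if t is TopFree then forall i, null (M i)
  else forall j, null (fun i => M i j).

Definition lform (t : top_kind) (I : Type) (f : I -> K) : Prop :=
  if t is TopFree then True else null f.

Definition app (I : choiceType) (J : Type) (M : I -> J -> K) (x : I -> K) :
  J -> K := fun j => ssum (fun i => x i * M i j).

Definition ev (I : choiceType) (f x : I -> K) : K := ssum (fun i => f i * x i).

Definition tens (I J : Type) (x : I -> K) (y : J -> K) : I * J -> K :=
  fun p => x p.1 * y p.2.

Definition tmor (I J I' J' : Type) (M : I -> J -> K) (N : I' -> J' -> K) :
  I * I' -> J * J' -> K := fun p q => M p.1 q.1 * N p.2 q.2.

Definition idmor (I : eqType) : I -> I -> K := fun i j => (i == j)%:R.

(* [f (x) id] and [id (x) f] on a tensor product, f a form. *)
Definition evl (I : choiceType) (J : Type) (f : I -> K) (z : I * J -> K) :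
  J -> K := fun j => ssum (fun i => f i * z (i, j)).
Definition evr (I : Type) (J : choiceType) (f : J -> K) (z : I * J -> K) :
  I -> K := fun i => ssum (fun j => f j * z (i, j)).

(* An algebra structure on the module of basis [I] is given by the products
   [m (i, j)] of pairs of basis elements. *)
Definition bmul (I : choiceType) (m : I * I -> I -> K) (x y : I -> K) :
  I -> K := app m (tens x y).

Definition tmul (I J : Type) (m : I * I -> I -> K) (m' : J * J -> J -> K) :
  (I * J) * (I * J) -> I * J -> K :=
  fun p r => m (p.1.1, p.2.1) r.1 * m' (p.1.2, p.2.2) r.2.

Record thopf (t : top_kind) := THopf {
  hidx : choiceType;
  hmulc : hidx * hidx -> hidx -> K;
  hone : hidx -> K;
  hcop : hidx -> hidx * hidx -> K;
  hcou : hidx -> K;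
  hant : hidx -> hidx -> K;
  hmulc_cont : lmor t hmulc;
  hone_vec : vec t hone;
  hcop_cont : lmor t hcop;
  hcou_cont : lform t hcou;
  hant_cont : lmor t hant;
  hmulA : forall x y z, vec t x -> vec t y -> vec t z ->
    bmul hmulc (bmul hmulc x y) z = bmul hmulc x (bmul hmulc y z);
  hmul1x : forall x, vec t x -> bmul hmulc hone x = x;
  hmulx1 : forall x, vec t x -> bmul hmulc x hone = x;
  hcopA : forall x, vec t x -> forall a b c,
    app (tmor hcop (@idmor hidx)) (app hcop x) ((a, b), c) =
    app (tmor (@idmor hidx) hcop) (app hcop x) (a, (b, c));
  hcoul : forall x, vec t x -> evl hcou (app hcop x) = x;
  hcour : forall x, vec t x -> evr hcou (app hcop x) = x;
  hcopM : forall x y, vec t x -> vec t y ->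
    app hcop (bmul hmulc x y) =
    bmul (tmul hmulc hmulc) (app hcop x) (app hcop y);
  hcop1 : app hcop hone = tens hone hone;
  hcouM : forall x y, vec t x -> vec t y ->
    ev hcou (bmul hmulc x y) = ev hcou x * ev hcou y;
  hcou1 : ev hcou hone = 1;
  hantl : forall x, vec t x ->
    app hmulc (app (tmor hant (@idmor hidx)) (app hcop x)) =
    (fun i => ev hcou x * hone i);
  hantr : forall x, vec t x ->
    app hmulc (app (tmor (@idmor hidx) hant) (app hcop x)) =
    (fun i => ev hcou x * hone i)
}.

Section HopfOps.
Variables (t : top_kind) (H : thopf t).
Local Notation I := (hidx H).

Definition hmul (x y : I -> K) : I -> K := bmul (@hmulc t H) x y.
Definition hcopr (x : I -> K) : I * I -> K := app (@hcop t H) x.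
Definition hcounit (x : I -> K) : K := ev (@hcou t H) x.

Definition hmulc2 := tmul (@hmulc t H) (@hmulc t H).
Definition hmul2 (x y : I * I -> K) : I * I -> K := bmul hmulc2 x y.
Definition hone2 : I * I -> K := tens (@hone t H) (@hone t H).
Definition hmul3 (x y : I * I * I -> K) : I * I * I -> K :=
  bmul (tmul hmulc2 (@hmulc t H)) x y.

Definition hpow2 (x : I * I -> K) (n : nat) : I * I -> K :=
  iter n (hmul2 x) hone2.

(* exp (h x) in the tensor square of H *)
Definition hexp2 (x : I * I -> K) : I * I -> K :=
  fun p => ssum (fun n => (n`!%:R)^-1 * hbar ^+ n * hpow2 x n p).

(* A bilinear form is given by its values on pairs of basis elements. *)
Definition bev (f : I * I -> K) (x y : I -> K) : K := ev f (tens x y).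

Definition conv (f g : I * I -> K) : I * I -> K := fun ab =>
  ssum (fun pq : (I * I) * (I * I) =>
    hcop ab.1 pq.1 * hcop ab.2 pq.2 *
    (f (pq.1.1, pq.2.1) * g (pq.1.2, pq.2.2))).

Definition conv1 : I * I -> K := tens (@hcou t H) (@hcou t H).

Definition convpow (f : I * I -> K) (n : nat) : I * I -> K :=
  iter n (conv f) conv1.

(* exp_* (h f) *)
Definition convexp (f : I * I -> K) : I * I -> K :=
  fun p => ssum (fun n => (n`!%:R)^-1 * hbar ^+ n * convpow f n p).

(* f(a_(1), b_(1)) g(a_(2) b_(2), c) *)
Definition cocl (f g : I * I -> K) (a b c : I -> K) : K :=
  ssum (fun pq : (I * I) * (I * I) =>
    hcopr a pq.1 * hcopr b pq.2 *
    (f (pq.1.1, pq.2.1) * bev g (hmulc (pq.1.2, pq.2.2)) c)).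

(* f(b_(1), c_(1)) g(a, b_(2) c_(2)) *)
Definition cocr (f g : I * I -> K) (a b c : I -> K) : K :=
  ssum (fun pq : (I * I) * (I * I) =>
    hcopr b pq.1 * hcopr c pq.2 *
    (f (pq.1.1, pq.2.1) * bev g a (hmulc (pq.1.2, pq.2.2)))).

Definition two_cocycle (s : I * I -> K) : Prop :=
  [/\ lform t s,
      exists s', [/\ lform t s', conv s s' = conv1 & conv s' s = conv1],
      forall a, vec t a ->
        bev s a (@hone t H) = hcounit a /\ bev s (@hone t H) a = hcounit a &
      forall a b c, vec t a -> vec t b -> vec t c ->
        cocl s s a b c = cocr s s a b c].

Definition twist (F : I * I -> K) : Prop :=
  [/\ vec t F,
      exists F', [/\ vec t F', hmul2 F F' = hone2 & hmul2 F' F = hone2],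
      evl (@hcou t H) F = @hone t H /\ evr (@hcou t H) F = @hone t H &
      hmul3 (tens F (@hone t H)) (app (tmor (@hcop t H) (@idmor I)) F) =
      hmul3 (fun abc => hone abc.1.1 * F (abc.1.2, abc.2))
        (fun abc => app (tmor (@idmor I) (@hcop t H)) F
                      (abc.1.1, (abc.1.2, abc.2)))].

End HopfOps.

Definition lie_bracket (g : vectType k) (br : g -> g -> g) : Prop :=
  [/\ forall a x y z, br (a *: x + y) z = a *: br x z + br y z,
      forall a x y z, br x (a *: y + z) = a *: br x y + br x z,
      forall x, br x x = 0 &
      forall x y z, br x (br y z) + br y (br z x) + br z (br x y) = 0].

Definition enveloping (g : vectType k) (br : g -> g -> g)
    (A : algType k) (i : {linear g -> A}) : Prop :=
  (forall x y, i (br x y) = i x * i y - i y * i x) /\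
  forall (C : algType k) (f : {linear g -> C}),
    (forall x y, f (br x y) = f x * f y - f y * f x) ->
    (exists u : {lrmorphism A -> C}, forall x, u (i x) = f x) /\
    (forall u v : {lrmorphism A -> C},
      (forall x, u (i x) = v (i x)) -> u =1 v).

(* [r] induces an isomorphism of k-algebras from U/hU onto U(g); it is one of
   Hopf algebras because the elements of g, which generate U(g), are primitive
   in U/hU too. *)
Definition is_quea (U : thopf TopFree) : Prop :=
  exists (g : vectType k) (br : g -> g -> g) (A : algType k)
         (i : {linear g -> A}) (r : (hidx U -> K) -> A),
  [/\ lie_bracket br /\ enveloping br i,
      [/\ forall x y, null x -> null y -> r (x \+ y) = r x + r y,
          forall c x, null x -> r (fun b => c * x b) = fcoef c 0 *: r x,
          r (@hone _ U) = 1 &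
          forall x y, null x -> null y -> r (hmul x y) = r x * r y],
      forall a, exists2 x, null x & r x = a,
      forall x, null x -> (r x = 0 <-> hdvdv 1 x) &
      forall v x, null x -> r x = i v ->
        hdvdv 1 (hcopr x \- (tens x (@hone _ U) \+ tens (@hone _ U) x)) /\
        hdvd 1 (hcounit x)].

Definition monom (d : nat) := {ffun 'I_d -> nat}.

Definition mfps_mul (d : nat) (u v : monom d -> k) : monom d -> k := fun m =>
  \sum_(p \in [set p : monom d * monom d | forall i, m i = (p.1 i + p.2 i)%N])
    u p.1 * v p.2.

Definition mfps_one (d : nat) : monom d -> k :=
  fun m => (m == [ffun=> 0%N])%:R.

(* [r] induces an isomorphism of augmented topological algebras from F/hF onto
   k[[x_1, ..., x_d]].  The formal group G is the Hopf structure transported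
   by it, a formal group law being the same thing as the values of a
   coproduct of k[[x_1, ..., x_d]] on x_1, ..., x_d. *)
Definition is_qfsha (F : thopf TopProd) : Prop :=
  exists (d : nat) (r : (hidx F -> K) -> monom d -> k),
  [/\ [/\ forall x y, r (x \+ y) = (fun m => r x m + r y m),
          forall c x, r (fun e => c * x e) = (fun m => fcoef c 0 * r x m),
          r (@hone _ F) = @mfps_one d &
          forall x y, r (hmul x y) = mfps_mul (r x) (r y)],
      forall u, exists x, r x = u,
      forall x, r x = (fun=> 0) <-> hdvdv 1 x,
      forall x, fcoef (hcounit x) 0 = r x [ffun=> 0%N] &
      (* bicontinuity, for the product topologies *)
      (forall m, exists2 A : set (hidx F), finite_set A &
         forall x, (forall e, A e -> fcoef (x e) 0 = 0) -> r x m = 0) /\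
      (forall e, exists2 A : set (monom d), finite_set A &
         forall x, (forall m, A m -> r x m = 0) -> fcoef (x e) 0 = 0)].

(* Continuous from the product topology of k[[h]]^E to the h-adic one. *)
Definition ph_continuous (I J : Type) (M : I -> J -> K) : Prop :=
  (forall i, null (M i)) /\
  (forall n, finite_set [set i | ~ hdvdv n (M i)]).

Definition hopf_map (F : thopf TopProd) (U : thopf TopFree)
    (j : hidx F -> hidx U -> K) : Prop :=
  [/\ forall x y, app j (hmul x y) = hmul (app j x) (app j y),
      app j (@hone _ F) = @hone _ U,
      forall x, hcopr (app j x) = app (tmor j j) (hcopr x),
      forall x, hcounit (app j x) = hcounit x &
      forall x, app (@hant _ U) (app j x) = app j (app (@hant _ F) x)].

Section Prime.
Variable U : thopf TopFree.
Local Notation B := (hidx U).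

(* The iterated coproduct with values in the n-th tensor power, from the
   counit for n = 0, by applying the coproduct of U and then id (x) itself;
   n = 1 gives the identity, n = 2 the coproduct of U. *)
Fixpoint itercop (n : nat) : B -> n.-tuple B -> K :=
  if n is m.+1 then fun b s =>
    ssum (fun c => hcop b (thead s, c) * itercop c [tuple of behead s])
  else fun b _ => @hcou _ U b.

Definition augproj : B -> B -> K :=
  fun b c => @idmor B b c - @hcou _ U b * @hone _ U c.

Definition delta (n : nat) (x : B -> K) : n.-tuple B -> K :=
  app (fun s s' : n.-tuple B => \prod_(i < n) augproj (tnth s i) (tnth s' i))
    (app (@itercop n) x).

Definition prime_elt (x : B -> K) : Prop :=
  null x /\ forall n, hdvdv n (@delta n x).

(* F is the QFSHA U', embedded into U by [j].  The topology of F is its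
   I-adic one for I = hF + Ker(epsilon), and I^n is mapped into h^n U. *)
Definition is_drinfeld_prime (F : thopf TopProd) (j : hidx F -> B -> K) :
    Prop :=
  [/\ is_qfsha F, ph_continuous j, hopf_map j, injective (app j) &
      forall x, prime_elt x <-> exists a, app j a = x].

End Prime.

Section Vee.
Variable F : thopf TopProd.
Local Notation E := (hidx F).

Definition aug_ideal (x : E -> K) : Prop :=
  exists y z, hcounit z = 0 /\ x = (fun e => hbar * y e + z e).

Fixpoint ideal_pow (n : nat) (x : E -> K) : Prop :=
  if n is m.+1 then
    exists (l : nat) (y z : 'I_l -> E -> K),
      (forall i, aug_ideal (y i) /\ ideal_pow m (z i)) /\
      x = (fun e => \sum_(i < l) hmul (y i) (z i) e)
  else True.

Definition toL (I : Type) (n : nat) (x : I -> K) : I -> L :=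
  fun i => (hbar%:F) ^- n * (x i)%:F.

(* sum_n h^-n I^n, inside the extension of scalars of F *)
Definition vee_lattice (z : E -> L) : Prop :=
  exists (n : nat) (a : nat -> E -> K),
    (forall i, ideal_pow i (a i)) /\
    z = (fun e => \sum_(i < n.+1) toL i (a i) e).

(* The graph of the k((h))-linear extension of [app j]. *)
Definition extends_to (J : Type) (j : E -> J -> K) (z : E -> L) (w : J -> L) :
    Prop :=
  exists n a, z = toL n a /\ w = toL n (app j a).

(* U is the QUEA which is the completion of D := sum_n h^-n I^n, the
   completion map being the linear extension of [j]: it maps D to U and
   induces isomorphisms from D/h^n D onto U/h^n U. *)
Definition is_drinfeld_vee (U : thopf TopFree) (j : E -> hidx U -> K) : Prop :=
  [/\ is_quea U, ph_continuous j /\ hopf_map j,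
      forall z w, vee_lattice z -> extends_to j z w ->
        exists2 u, null u & w = toL 0 u,
      forall n u, null u -> exists z w v,
        [/\ vee_lattice z, extends_to j z w, null v &
            toL 0 u = (fun b => w b + hbar%:F ^+ n * (v b)%:F)] &
      forall n z u, vee_lattice z -> null u ->
        extends_to j z (toL 0 (fun b => hbar ^+ n * u b)) ->
        exists2 z', vee_lattice z' & z = (fun e => hbar%:F ^+ n * z' e)].

End Vee.

Definition lsum_to (I : choiceType) (x : I -> L) (s : L) : Prop :=
  forall n, exists A : {fset I}, forall A' : {fset I}, (A `<=` A')%fset ->
    exists r : K, \sum_(i <- A') x i - s = hbar%:F ^+ n * r%:F.

(* The same in k((h)) (x) M, for M topologically free. *)
Definition lvsum_to (I : choiceType) (J : Type) (x : I -> J -> L)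
    (s : J -> L) : Prop :=
  forall n, exists A : {fset I}, forall A' : {fset I}, (A `<=` A')%fset ->
    exists2 r : J -> K, null r &
      forall j, \sum_(i <- A') x i j - s j = hbar%:F ^+ n * (r j)%:F.

Section PolarCocycle.
Variable U : thopf TopFree.
Local Notation B := (hidx U).

(* The terms of the series sigma(x, y), for sigma = exp_* (h^-1 chi). *)
Definition polar_terms (chi : B * B -> K) (x y : B -> K) (n : nat) : L :=
  (n`!%:R)^-1 * (hbar%:F) ^- n * (bev (convpow chi n) x y)%:F.

(* The terms of the two members of the cocycle identity for sigma. *)
Definition polar_cocl (chi : B * B -> K) (a b c : B -> K) (nm : nat * nat) : L :=
  (nm.1`!%:R * nm.2`!%:R)^-1 * (hbar%:F) ^- (nm.1 + nm.2) *
  (cocl (convpow chi nm.1) (convpow chi nm.2) a b c)%:F.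
Definition polar_cocr (chi : B * B -> K) (a b c : B -> K) (nm : nat * nat) : L :=
  (nm.1`!%:R * nm.2`!%:R)^-1 * (hbar%:F) ^- (nm.1 + nm.2) *
  (cocr (convpow chi nm.1) (convpow chi nm.2) a b c)%:F.

(* exp_* (h^-1 chi) is a polar 2-cocycle.  Its series need not converge on the
   whole of U (for U = S(g)[[h]] with g abelian and chi the extension of a
   nonzero bilinear form of g it does not), so that the cocycle identity is
   required wherever its two members converge.  Normalisation and convolution
   invertibility, with inverse exp_* (- h^-1 chi), follow from the first
   condition, and extension of scalars to k((h)) from linearity. *)
Definition polar_cocycle (chi : B * B -> K) : Prop :=
  (forall z, null z ->
     bev chi z (@hone _ U) = 0 /\ bev chi (@hone _ U) z = 0) /\
  (forall a b c, null a -> null b -> null c -> forall s s',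
     lsum_to (polar_cocl chi a b c) s -> lsum_to (polar_cocr chi a b c) s' ->
     s = s').

End PolarCocycle.

(* [Tw] is exp (h^-1 phi), where phi is mapped to the tensor square of U, the
   QUEA of F. *)
Definition polar_twist (F : thopf TopProd) (U : thopf TopFree)
    (j : hidx F -> hidx U -> K) (phi : hidx F * hidx F -> K)
    (Tw : hidx U * hidx U -> K) : Prop :=
  [/\ evr (@hcou _ F) phi = (fun=> 0) /\ evl (@hcou _ F) phi = (fun=> 0),
      null Tw,
      lvsum_to (fun n p => (n`!%:R)^-1 * toL n (hpow2 (app (tmor j j) phi) n) p)
        (toL 0 Tw) &
      twist Tw].

End Modules.

(* Main.v *)
(** An element of U' differs from its counit by an element of h U, and dually
    the image in the dual QUEA of an element of Ker(epsilon) lies in h U.  A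
    form which vanishes on the unit in each argument (resp. an exponent killed
    by the counit on each side) thus gains one factor h per tensor leg, that is
    h^2 in total: this turns h^-1 chi into h chi' and h^-1 phi into h phi^vee,
    whose exponentials converge.  As F -> U is a morphism of Hopf algebras,
    pulling back forms along it commutes with convolution and with both members
    of the cocycle identity, so that the latter descends term by term. *)

Require Import Defs.
From HB Require Import structures.
From mathcomp Require Import all_boot all_algebra.
From mathcomp Require Import finmap boolp classical_sets functions cardinality.
From mathcomp Require Import fsbigop.
From mathcomp Require Import ring.

Set Implicit Arguments.
Unset Strict Implicit.
Unset Printing Implicit Defensive.

Import GRing.Theory.
Local Open Scope ring_scope.

(** Sums are taken coefficientwise by [ssum], which is meaningful for [null] families only, so every
    exchange of summations needs a nullity argument. Forms on the topologically free side have no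
    decay at all. What allows them to be restricted to F is that the matrix of F -> U is null in
    both indices jointly ([jnull]), a consequence of [ph_continuous]: every form then pulls back to
    a null one, and sums along [j] can be exchanged whatever the form and the vector.

    The second obstacle is that the polar identity is given only between sums that converge in
    k((h)). It is applied to images of elements of F. There the (n, m) term, once the two powers of
    chi have released h^(2n+2m), is a power series that tends to 0 with n + m, and the equality
    returns to k[[h]] because k[[h]] -> k((h)) is injective. Characteristic 0 serves to invert n! in
    k[[h]].

    The factor h of each leg has two sources: delta_1 = id - iota epsilon has values in hU on U',
    and h^-1 Ker(epsilon) is part of the lattice that is mapped into the dual QUEA. *)

(** * The h-adic valuation on power series *)

Section Divisibility.
Variable k : fieldType.
Local Notation K := (fps k).
Implicit Types (f g : K) (n : nat).

Lemma fcoefD f g n : fcoef (f + g) n = fcoef f n + fcoef g n.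
Proof. by []. Qed.

Lemma fcoef_sum (I : Type) (r : seq I) (F : I -> K) n :
  fcoef (\sum_(i <- r) F i) n = \sum_(i <- r) fcoef (F i) n.
Proof. by elim: r => [|i r IHr]; rewrite ?big_nil// !big_cons fcoefD IHr. Qed.

Lemma fcoef_hbarM f n :
  fcoef (hbar * f) n = if n is m.+1 then fcoef f m else 0.
Proof.
case: n => [|n]; first by rewrite /= big_ord1 /= mul0r.
rewrite /= !big_ord_recl /= mul0r add0r mul1r subSS subn0.
by rewrite big1 ?addr0// => i _; rewrite mul0r.
Qed.

(** Drops the first [n] coefficients, and so is a total division by [hbar ^+ n], exact on its
    multiples by [hdvd_shift]. It allows the rescaled forms to be defined before divisibility is
    known. *)
Definition hshift n f : K := Fps (fun m => fcoef f (n + m)%N).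

Lemma hdvdP n f : hdvd n f <-> forall m, (m < n)%N -> fcoef f m = 0.
Proof.
split=> [[g ->]|f0].
  elim: n => // n IHn [|m]; rewrite ltnS => mn; rewrite exprS -mulrA.
    by rewrite fcoef_hbarM.
  by rewrite fcoef_hbarM IHn.
exists (hshift n f); elim: n f f0 => [|n IHn] f f0.
  by rewrite mul1r; apply/fpsP.
rewrite exprS -mulrA; apply/fpsP => -[|m]; rewrite fcoef_hbarM; first exact: f0.
have -> : hshift n.+1 f = hshift n (hshift 1 f) by [].
by rewrite -IHn// => i ltin; apply: f0.
Qed.

Lemma hdvd_shift n f : hdvd n f -> f = hbar ^+ n * hshift n f.
Proof.
move=> [g ->]; congr (_ * _); elim: n => [|n IHn].
  by rewrite mul1r; apply/fpsP.
by rewrite {1}IHn; apply/fpsP => m; rewrite exprS -mulrA [RHS]fcoef_hbarM.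
Qed.

Lemma hbar_neq0 : hbar != 0 :> K.
Proof. by apply/eqP => /fpsP /(_ 1%N) /eqP; rewrite /= oner_eq0. Qed.

Lemma hexpI n : injective ( *%R (hbar ^+ n : K)).
Proof. exact: (mulfI (expf_neq0 n hbar_neq0)). Qed.

Lemma hdvd0 n : hdvd n (0 : K). Proof. by exists 0; rewrite mulr0. Qed.

Lemma hdvd0n f : hdvd 0 f. Proof. by exists f; rewrite mul1r. Qed.

Lemma hdvdD n f g : hdvd n f -> hdvd n g -> hdvd n (f + g).
Proof. by move=> [f' ->] [g' ->]; exists (f' + g'); rewrite mulrDr. Qed.

Lemma hdvdN n f : hdvd n f -> hdvd n (- f).
Proof. by move=> [f' ->]; exists (- f'); rewrite mulrN. Qed.

Lemma hdvdM m n f g : hdvd m f -> hdvd n g -> hdvd (m + n) (f * g).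
Proof. by move=> [f' ->] [g' ->]; exists (f' * g'); rewrite exprD mulrACA. Qed.

Lemma hdvdMl n f g : hdvd n g -> hdvd n (f * g).
Proof. exact: (hdvdM (hdvd0n f)). Qed.

Lemma hdvdMr n f g : hdvd n f -> hdvd n (f * g).
Proof. by rewrite mulrC; apply: hdvdMl. Qed.

Lemma hdvd_sum (I : eqType) (r : seq I) n (F : I -> K) :
  (forall i, i \in r -> hdvd n (F i)) -> hdvd n (\sum_(i <- r) F i).
Proof.
move=> hF; rewrite big_seq; elim/big_rec: _ => [|i x ir hx]; first exact: hdvd0.
exact: hdvdD (hF _ ir) hx.
Qed.

Lemma hdvd_le m n f : (m <= n)%N -> hdvd n f -> hdvd m f.
Proof.
by move=> mn /hdvdP h; apply/hdvdP => i im; apply: h; apply: leq_trans mn.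
Qed.

Lemma hdvd_exp m n f : (m <= n)%N -> hdvd m (hbar ^+ n * f).
Proof. by move=> mn; apply: (hdvd_le mn); exists f. Qed.

Lemma hdvd_sep f g : (forall n, hdvd n (f - g)) -> f = g.
Proof.
move=> h; apply/eqP; rewrite -subr_eq0; apply/eqP/fpsP => n.
by have /hdvdP := h n.+1; apply.
Qed.

Lemma hdvd_trans n f g l : hdvd n (f - g) -> hdvd n (g - l) -> hdvd n (f - l).
Proof. by move=> h1 h2; rewrite -(subrK g f) -addrA; apply: hdvdD. Qed.

Lemma hdvd_sym n f g : hdvd n (f - g) -> hdvd n (g - f).
Proof. by move=> /hdvdN; rewrite opprB. Qed.

Lemma hexp_dvdI m n f : hdvd (m + n) (hbar ^+ m * f) -> hdvd n f.
Proof. by move=> [g]; rewrite exprD -mulrA => /hexpI ->; exists g. Qed.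

Lemma hbar_valuation f : f != 0 ->
  exists n u, f = hbar ^+ n * u /\ u \is a GRing.unit.
Proof.
move=> f0; have ex : exists n, fcoef f n != 0.
  apply: contrapT => /forallNP nf; move/eqP: f0; apply.
  by apply/fpsP => n; apply/eqP/negPn/negP/nf.
case: (ex_minnP ex) => n fn min; exists n, (hshift n f); split.
  apply/hdvd_shift/hdvdP => m mn.
  by apply/eqP/negPn/negP => /min; rewrite leqNgt mn.
by rewrite -[_ \is a _]/(fcoef f (n + 0)%N != 0) addn0.
Qed.

(** [m] is the valuation of [f]. The loss of divisibility is uniform in [g], so a whole null family
    can be divided by a nonzero scalar and stay null ([null_mulI]). *)
Lemma hdvd_mulI f : f != 0 -> exists m, forall n g, hdvd (m + n) (f * g) -> hdvd n g.
Proof.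
move=> /hbar_valuation [m [u [-> uu]]]; exists m => n g.
rewrite -mulrA => /hexp_dvdI [g' ug]; exists (u^-1 * g').
by rewrite mulrCA -ug mulKr.
Qed.

End Divisibility.

(** * Summation of null families *)
Section NullFamilies.
Variable k : fieldType.
Local Notation K := (fps k).
Implicit Types (I J : choiceType) (n : nat).

Lemma nullP I (x : I -> K) :
  null x <-> forall n, exists A : {fset I}, forall i, i \notin A -> hdvd n (x i).
Proof.
split=> [h n|h n].
  have /finite_fsetP [A eA] := h n; exists A => i iA.
  by apply: contrapT => xi; move/negP: iA; apply; move: eA => /seteqP [/(_ i xi)].
have [A hA] := h n; apply: (@sub_finite_set _ _ [set` A]) => [i /= nx|].
  by apply: contrapT => /negP /hA.
exact: finite_fset.
Qed.

Lemma null_mull (I : Type) (c x : I -> K) : null x -> null (fun i => c i * x i).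
Proof.
by move=> h n; apply: sub_finite_set (h n) => i /= ncx xi; apply/ncx/hdvdMl.
Qed.

Lemma null_mulr (I : Type) (c x : I -> K) : null x -> null (fun i => x i * c i).
Proof.
by move=> h n; apply: sub_finite_set (h n) => i /= ncx xi; apply/ncx/hdvdMr.
Qed.

Lemma null_mulI (I : Type) (c : K) (x : I -> K) :
  c != 0 -> null (fun i => c * x i) -> null x.
Proof.
move=> /hdvd_mulI [m cm] h n; apply: sub_finite_set (h (m + n)%N) => i /=.
by move=> nx /cm.
Qed.

Lemma nullD I (x y : I -> K) : null x -> null y -> null (fun i => x i + y i).
Proof.
move=> /nullP hx /nullP hy; apply/nullP => n.
have [A hA] := hx n; have [B hB] := hy n; exists (A `|` B)%fset => i.
by rewrite inE negb_or => /andP [/hA ? /hB ?]; apply: hdvdD.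
Qed.

Lemma null_inj (I J : Type) (x : I -> K) (f : J -> I) :
  injective f -> null x -> null (fun j => x (f j)).
Proof.
by move=> fI h n; apply: (finite_preimage _ (h n)) => i j _ _; apply: fI.
Qed.

Lemma null_hpow (c : nat -> K) : null (fun n => hbar ^+ n * c n).
Proof.
apply/nullP => n; exists [fset i | i in iota 0 n]%fset => i.
by rewrite !inE mem_iota /= -leqNgt => /hdvd_exp.
Qed.

(** Modulo [hbar ^+ n] finitely many rows survive, and each of them has finitely many entries left.
    The uniform condition on rows is what [ph_continuous] supplies. *)
Lemma null_uncurry I J (x : I -> J -> K) : (forall i, null (x i)) ->
  (forall n, finite_set [set i | ~ hdvdv n (x i)]) ->
  null (fun p => x p.1 p.2).
Proof.
move=> hx hfin; apply/nullP => n; have /finite_fsetP [A eA] := hfin n.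
have /choice [B hB] : forall i, exists B : {fset J}, forall j, j \notin B ->
  hdvd n (x i j) by move=> i; have /nullP := hx i; apply.
exists [fset p | p in [seq (i, j) | i <- A, j <- B i]]%fset => -[i j].
rewrite !inE /= => nij; have [iA|iA] := boolP (i \in A).
  apply/hB/negP => jB; move/negP: nij; apply.
  by apply/allpairsPdep; exists i, j.
have : hdvdv n (x i) by apply: contrapT => xi; move/negP: iA; apply;
  move: eA => /seteqP [/(_ i xi)].
exact.
Qed.

(** Here the weights [x] make almost all rows vanish modulo [hbar ^+ n]; no uniformity in the rows
    [M i] is asked for. *)
Lemma null_dep I J (x : I -> K) (M : I -> J -> K) :
  null x -> (forall i, null (M i)) -> null (fun p => x p.1 * M p.1 p.2).
Proof.
move=> hx hM; apply: (null_uncurry (x := fun i j => x i * M i j)) => [i|n].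
  exact: null_mull.
by apply: sub_finite_set (hx n) => i /= nx xi; apply: nx => j; apply: hdvdMr.
Qed.

Lemma null_swap I J (x : I * J -> K) : null x -> null (fun p => x (p.2, p.1)).
Proof. by apply: null_inj => -[? ?] [? ?] [-> ->]. Qed.

Lemma null_dep_swap I J (x : J -> K) (M : I -> J -> K) :
  null x -> (forall j, null (fun i => M i j)) -> null (fun p => M p.1 p.2 * x p.2).
Proof.
move=> hx hM; have /null_swap := null_dep hx hM.
by congr null; apply: funext => p /=; rewrite mulrC.
Qed.

Lemma null_tens I J (x : I -> K) (y : J -> K) : null x -> null y -> null (tens x y).
Proof. by move=> hx hy; apply: (null_dep hx (fun=> hy)). Qed.

Lemma null_fiberl I J (x : I * J -> K) j : null x -> null (fun i => x (i, j)).
Proof. by apply: null_inj => ? ? []. Qed.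

Lemma null_fiberr I J (x : I * J -> K) i : null x -> null (fun j => x (i, j)).
Proof. by apply: null_inj => ? ? []. Qed.

(** The precision [n] is fixed, and [A] has to contain the supports of the coefficients below [n]
    only. So [x] may fail to be null, which makes [hdvd_ssum] valid for arbitrary families. *)
Lemma ssum_approx I (x : I -> K) (A : {fset I}) n :
  (forall i, i \notin A -> hdvd n (x i)) -> hdvd n (ssum x - \sum_(i <- A) x i).
Proof.
move=> h; apply/hdvdP => m mn; rewrite fcoefD; apply/eqP; rewrite subr_eq0.
rewrite fcoef_sum /=; apply/eqP; rewrite (@fsbigE _ _ _ _ _ A) ?fset_uniq//.
  by apply: eq_bigl => i; rewrite in_setT.
by move=> i _ /h /hdvdP; apply.
Qed.

Lemma eq_ssum I (x y : I -> K) : x =1 y -> ssum x = ssum y.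
Proof. by move=> /funext ->. Qed.

Lemma hdvd_ssum I (x : I -> K) n : (forall i, hdvd n (x i)) -> hdvd n (ssum x).
Proof.
by move=> h; have := @ssum_approx _ x fset0 n; rewrite big_nil subr0; apply.
Qed.

Lemma ssum_unique I (x : I -> K) s :
  (forall n, exists A : {fset I}, (forall i, i \notin A -> hdvd n (x i)) /\
     hdvd n (\sum_(i <- A) x i - s)) -> ssum x = s.
Proof.
move=> h; apply: hdvd_sep => n; have [A [hA hs]] := h n.
exact: hdvd_trans (ssum_approx hA) hs.
Qed.

Lemma ssum0 I : ssum (fun _ : I => 0 : K) = 0.
Proof.
by apply: ssum_unique => n; exists fset0; rewrite big_nil subr0; split=> *; apply: hdvd0.
Qed.

Lemma ssum_supp1 I (x : I -> K) i0 : (forall i, i != i0 -> x i = 0) -> ssum x = x i0.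
Proof.
move=> h; apply: ssum_unique => n; exists [fset i0]%fset; split.
  by move=> i; rewrite inE => /h ->; apply: hdvd0.
by rewrite big_seq_fset1 subrr; apply: hdvd0.
Qed.

Lemma ssum_idmorl I (x : I -> K) i : ssum (fun j => @idmor k I i j * x j) = x i.
Proof.
rewrite (@ssum_supp1 _ _ i) /idmor ?eqxx ?mul1r// => j.
by rewrite eq_sym => /negbTE ->; rewrite mul0r.
Qed.

Lemma ssumD I (x y : I -> K) : null x -> null y ->
  ssum (fun i => x i + y i) = ssum x + ssum y.
Proof.
move=> /nullP hx /nullP hy; apply: ssum_unique => n.
have [A hA] := hx n; have [B hB] := hy n.
have xAB i : i \notin (A `|` B)%fset -> hdvd n (x i).
  by rewrite inE negb_or => /andP [/hA].
have yAB i : i \notin (A `|` B)%fset -> hdvd n (y i).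
  by rewrite inE negb_or => /andP [_ /hB].
exists (A `|` B)%fset; split=> [i iAB|]; first exact: hdvdD (xAB _ iAB) (yAB _ iAB).
rewrite big_split /= opprD addrACA.
by apply: hdvdD; apply: hdvd_sym; apply: ssum_approx.
Qed.

(* [x] itself is null unless [c = 0], K being a domain; otherwise [ssum x] could
   be a junk value. *)
Lemma ssumZ I (c : K) (x : I -> K) : null (fun i => c * x i) ->
  ssum (fun i => c * x i) = c * ssum x.
Proof.
have [-> _|c0 hcx] := eqVneq c 0.
  by rewrite mul0r -[RHS](ssum0 I); apply: eq_ssum => i; rewrite mul0r.
have /nullP hx := null_mulI c0 hcx; apply: ssum_unique => n.
have [A hA] := hx n; exists A; split=> [i /hA|]; first exact: hdvdMl.
by rewrite -mulr_sumr -mulrBr; apply/hdvdMl/hdvd_sym/ssum_approx.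
Qed.

Lemma ssumZr I (c : K) (x : I -> K) : null (fun i => x i * c) ->
  ssum (fun i => x i * c) = ssum x * c.
Proof.
rewrite [RHS]mulrC => h; rewrite -ssumZ; first by apply: eq_ssum => i; rewrite mulrC.
by congr null: h; apply: funext => i; rewrite mulrC.
Qed.

Lemma ssum_pair I J (x : I -> J -> K) : null (fun p : I * J => x p.1 p.2) ->
  ssum (fun p : I * J => x p.1 p.2) = ssum (fun i => ssum (x i)).
Proof.
move=> /nullP hx; apply: ssum_unique => n; have [A hA] := hx n.
(* [A] is enlarged to the rectangle spanned by its projections, over which the finite double sum
   splits. *)
pose A1 := [fset p.1 | p in A]%fset; pose A2 := [fset p.2 | p in A]%fset.
have x1 i : i \notin A1 -> forall j, hdvd n (x i j).
  move=> iA j; apply: (hA (i, j)); apply/negP => ijA; move/negP: iA; apply.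
  by apply/imfsetP; exists (i, j).
have x2 j : j \notin A2 -> forall i, hdvd n (x i j).
  move=> jA i; apply: (hA (i, j)); apply/negP => ijA; move/negP: jA; apply.
  by apply/imfsetP; exists (i, j).
exists (A1 `*` A2)%fset; split.
  by case=> i j; rewrite in_fsetM negb_and => /orP [/x1|/x2].
rewrite /fsetM big_imfset2 /=; last by move=> [i j] [i' j'] _ _ /= [-> ->].
apply: (@hdvd_trans _ _ _ (\sum_(i <- A1) ssum (x i))).
  rewrite -sumrB; apply: hdvd_sum => i _; apply/hdvd_sym/ssum_approx => j jA.
  exact: x2.
apply/hdvd_sym/ssum_approx => i iA; apply: hdvd_ssum => j; exact: x1.
Qed.

Lemma null_ssum I J (x : I -> J -> K) :
  null (fun p : I * J => x p.1 p.2) -> null (fun i => ssum (x i)).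
Proof.
move=> /nullP hx; apply/nullP => n; have [A hA] := hx n.
exists [fset p.1 | p in A]%fset => i iA; apply: hdvd_ssum => j.
apply: (hA (i, j)); apply/negP => ijA; move/negP: iA; apply.
by apply/imfsetP; exists (i, j).
Qed.

Lemma ssum_reindex I J (h : J -> I) (x : I -> K) :
  bijective h -> ssum x = ssum (fun j => x (h j)).
Proof. by move=> hb; apply/fpsP => n; apply: reindex_fsbigT. Qed.

Lemma ssum_exchange I J (x : I -> J -> K) : null (fun p : I * J => x p.1 p.2) ->
  ssum (fun i => ssum (x i)) = ssum (fun j => ssum (fun i => x i j)).
Proof.
move=> hx; rewrite -ssum_pair// -(ssum_pair (null_swap hx)).
apply: (ssum_reindex (h := fun p : J * I => (p.2, p.1))).
by exists (fun p => (p.2, p.1)); case.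
Qed.

Lemma ssumM I J (x : I -> K) (y : J -> K) : null x -> null y ->
  ssum x * ssum y = ssum (fun p : I * J => x p.1 * y p.2).
Proof.
move=> hx hy; rewrite (ssum_pair (x := fun i j => x i * y j)); last exact: null_tens.
rewrite -ssumZr; last exact: null_mulr.
by apply: eq_ssum => i; rewrite ssumZ//; apply: null_mull.
Qed.

Lemma ssum_approx_nat (x : nat -> K) N n :
  (forall i, (N <= i)%N -> hdvd n (x i)) -> hdvd n (ssum x - \sum_(i < N) x i).
Proof.
move=> h; rewrite -(big_mkord xpredT); set A := [fset i in iota 0 N]%fset.
have -> : \sum_(0 <= i < N) x i = \sum_(i <- A) x i.
  apply: perm_big; apply: uniq_perm; rewrite ?iota_uniq ?fset_uniq// => i.
  by rewrite !inE mem_index_iota mem_iota.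
by apply: ssum_approx => i; rewrite !inE mem_iota /= -leqNgt; apply: h.
Qed.

Lemma null_natP (x : nat -> K) n : null x ->
  exists N, forall i, (N <= i)%N -> hdvd n (x i).
Proof.
move=> /nullP /(_ n) [A hA]; exists (\max_(i <- A) i).+1 => i ltAi.
apply: hA; apply: contraL ltAi => iA; rewrite -leqNgt.
by rewrite (big_rem i)//= leq_maxl.
Qed.

Lemma ssum_nat_recl (x : nat -> K) : null x ->
  ssum x = x 0%N + ssum (fun n => x n.+1).
Proof.
move=> hx; apply: hdvd_sep => n; have [N hN] := null_natP n hx.
have h1 : hdvd n (ssum x - \sum_(i < N.+1) x i).
  by apply: ssum_approx_nat => i /ltnW /hN.
have h2 : hdvd n (ssum (fun n => x n.+1) - \sum_(i < N) x i.+1).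
  by apply: ssum_approx_nat => i /leqW /hN.
apply: hdvd_trans h1 _; rewrite big_ord_recl opprD addrACA subrr add0r.
exact: hdvd_sym.
Qed.

Lemma lsum_to_ssum I (x : I -> K) : null x ->
  lsum_to (fun i => tofrac (x i)) (tofrac (ssum x)).
Proof.
move=> /nullP hx n; have [A hA] := hx n; exists A => A' /fsubsetP AA'.
have [|r hr] := @ssum_approx _ x A' n.
  by move=> i iA'; apply: hA; apply: contra iA'; apply: AA'.
exists (- r); rewrite -(rmorph_sum (@tofrac _)) -rmorphB -rmorphXn -rmorphM.
by rewrite mulrN -hr opprB.
Qed.

Lemma lsum_to_unique I (x : I -> K) s :
  null x -> lsum_to (fun i => tofrac (x i)) (tofrac s) -> ssum x = s.
Proof.
move=> /nullP hx hs; apply: ssum_unique => n.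
have [A hA] := hx n; have [A' /(_ (A `|` A')%fset (fsubsetUr _ _)) [r hr]] := hs n.
(* One set controls the tail of [ssum], the other the distance to [s]; the union does both. *)
exists (A `|` A')%fset; split.
  by move=> i; rewrite inE negb_or => /andP [/hA].
exists r; apply/eqP; rewrite -tofrac_eq tofracM tofracXn -hr tofracB.
by rewrite -(rmorph_sum (@tofrac _)).
Qed.

End NullFamilies.

(** * Continuous linear maps and forms *)
Section Matrices.
Variable k : fieldType.
Local Notation K := (fps k).
Implicit Types (I J : choiceType) (n : nat) (t : top_kind).

Lemma eq_null (I : Type) (x y : I -> K) : x =1 y -> null x -> null y.
Proof. by move=> /funext ->. Qed.

Lemma nullZI (I : Type) n (x : I -> K) : null (fun i => hbar ^+ n * x i) -> null x.
Proof. exact/null_mulI/expf_neq0/hbar_neq0. Qed.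

Definition pull (I : Type) J (M : I -> J -> K) (f : J -> K) : I -> K :=
  fun i => ssum (fun j => M i j * f j).

(** Fubini for a triple product. Nullity is asked of the product itself, because it arises in three
    ways: decay of [x] and of the rows of [M], decay of [f] and of the columns, or decay of [M] in
    both indices at once. *)
Lemma ev_app I J (f : J -> K) (M : I -> J -> K) (x : I -> K) :
  null (fun p : I * J => x p.1 * M p.1 p.2 * f p.2) ->
  ev f (app M x) = ev (pull M f) x.
Proof.
move=> h; transitivity (ssum (fun j => ssum (fun i => x i * M i j * f j))).
  apply: eq_ssum => j; rewrite /app mulrC -ssumZr//.
  exact: (null_fiberl j h).
rewrite -(ssum_exchange h); apply: eq_ssum => i; rewrite /pull -ssumZr.
  by apply: eq_ssum => j; ring.
by apply: eq_null (null_fiberr i h) => j /=; ring.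
Qed.

Lemma null_idmor I (i : I) : null (@idmor k I i).
Proof.
apply/nullP => n; exists [fset i]%fset => j; rewrite inE /idmor eq_sym => /negbTE ->.
exact: hdvd0.
Qed.

Lemma app_idmor I (J : Type) (M : I -> J -> K) i : app M (@idmor k I i) = M i.
Proof. by apply: funext => j; apply: ssum_idmorl. Qed.

Lemma tens_idmor I J i j : tens (@idmor k I i) (@idmor k J j) = @idmor k _ (i, j).
Proof.
by apply: funext => -[i' j']; rewrite /tens /idmor -natrM mulnb -xpair_eqE.
Qed.

Lemma null_vec_lmor t I J (x : I -> K) (M : I -> J -> K) j :
  vec t x -> lmor t M -> null (fun i => x i * M i j).
Proof. by case: t => /= hx hM; [apply: null_mulr | apply: null_mull]. Qed.

Lemma null_lmor_lform t I J (M : I -> J -> K) (f : J -> K) i :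
  lmor t M -> lform t f -> null (fun j => M i j * f j).
Proof. by case: t => /= hM hf; [apply: null_mulr | apply: null_mull]. Qed.

Lemma null_vec_lform t I (x f : I -> K) :
  vec t x -> lform t f -> null (fun i => f i * x i).
Proof. by case: t => /= hx hf; [apply: null_mull | apply: null_mulr]. Qed.

Lemma null_vec_lmor_lform t I J (x : I -> K) (M : I -> J -> K) (f : J -> K) :
  vec t x -> lmor t M -> lform t f ->
  null (fun p : I * J => x p.1 * M p.1 p.2 * f p.2).
Proof.
case: t => /= hx hM hf; first by apply: null_mulr; apply: null_dep.
have := null_mull (fun p : I * J => x p.1) (null_dep_swap hf hM).
by apply: eq_null => p; rewrite mulrA.
Qed.

Lemma ev_app_kind t I J (x : I -> K) (M : I -> J -> K) (f : J -> K) :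
  vec t x -> lmor t M -> lform t f -> ev f (app M x) = ev (pull M f) x.
Proof. by move=> hx hM hf; apply: ev_app; apply: null_vec_lmor_lform hf. Qed.

Lemma vec_app t I J (x : I -> K) (M : I -> J -> K) :
  vec t x -> lmor t M -> vec t (app M x).
Proof.
case: t => //= hx hM; apply: (null_ssum (x := fun j i => x i * M i j)).
exact: (null_swap (null_dep hx hM)).
Qed.

Lemma lform_pull t I J (f : J -> K) (M : I -> J -> K) :
  lmor t M -> lform t f -> lform t (pull M f).
Proof.
by case: t => //= hM hf; apply: null_ssum (null_dep_swap hf hM).
Qed.

Lemma vec_tens t I J (x : I -> K) (y : J -> K) : vec t x -> vec t y -> vec t (tens x y).
Proof. by case: t => //=; apply: null_tens. Qed.

Lemma lform_tens t I J (f : I -> K) (g : J -> K) :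
  lform t f -> lform t g -> lform t (tens f g).
Proof. by case: t => //=; apply: null_tens. Qed.

Lemma lmor_tmor t I J I' J' (M : I -> J -> K) (N : I' -> J' -> K) :
  lmor t M -> lmor t N -> lmor t (tmor M N).
Proof.
case: t => /= hM hN [p q]; first exact: null_tens.
exact: (null_tens (hM p) (hN q)).
Qed.

Lemma app_tens I J I' J' (M : I -> J -> K) (N : I' -> J' -> K) x y :
  (forall j, null (fun i => x i * M i j)) ->
  (forall j, null (fun i => y i * N i j)) ->
  app (tmor M N) (tens x y) = tens (app M x) (app N y).
Proof.
move=> hM hN; apply: funext => -[p q]; rewrite /tens /app /= ssumM//.
by apply: eq_ssum => -[a b]; rewrite /tmor /=; ring.
Qed.

Lemma app_tens_kind t I J I' J' (M : I -> J -> K) (N : I' -> J' -> K) x y :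
  vec t x -> vec t y -> lmor t M -> lmor t N ->
  app (tmor M N) (tens x y) = tens (app M x) (app N y).
Proof.
move=> hx hy hM hN; apply: app_tens => j; first exact: (null_vec_lmor j hx hM).
exact: (null_vec_lmor j hy hN).
Qed.

Lemma pull_tens I J I' J' (M : I -> J -> K) (N : I' -> J' -> K) f g :
  (forall i, null (fun j => M i j * f j)) ->
  (forall i, null (fun j => N i j * g j)) ->
  pull (tmor M N) (tens f g) = tens (pull M f) (pull N g).
Proof.
move=> hM hN; apply: funext => -[p q]; rewrite /tens /pull /= ssumM//.
by apply: eq_ssum => -[a b]; rewrite /tmor /=; ring.
Qed.

Lemma ev_tens I J (f x : I -> K) (g y : J -> K) :
  null (fun i => f i * x i) -> null (fun j => g j * y j) ->
  ev (tens f g) (tens x y) = ev f x * ev g y.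
Proof.
by move=> hf hg; rewrite /ev ssumM//; apply: eq_ssum => p; rewrite /tens; ring.
Qed.

Lemma evZ I (f x : I -> K) c : null (fun i => f i * x i) ->
  ev f (fun i => c * x i) = c * ev f x.
Proof.
move=> h; rewrite /ev -ssumZ; last exact: null_mull.
by apply: eq_ssum => i; ring.
Qed.

Lemma evZl I (f x : I -> K) c : null (fun i => f i * x i) ->
  ev (fun i => c * f i) x = c * ev f x.
Proof.
move=> h; rewrite /ev -ssumZ; last exact: null_mull.
by apply: eq_ssum => i; ring.
Qed.

Lemma evD I (f x y : I -> K) : null (fun i => f i * x i) -> null (fun i => f i * y i) ->
  ev f (fun i => x i + y i) = ev f x + ev f y.
Proof.
by move=> hx hy; rewrite /ev -ssumD//; apply: eq_ssum => i; rewrite mulrDr.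
Qed.

Lemma ev_idmor I (f : I -> K) i : ev f (@idmor k I i) = f i.
Proof.
by rewrite /ev -[RHS](ssum_idmorl f); apply: eq_ssum => j; rewrite mulrC.
Qed.

(** The form f (x) g with the two middle legs exchanged. Convolutions and both members of the
    cocycle identity are its values on a tensor product of two coproducts, so [pull_shuffle] serves
    for all of them. *)
Definition shuffle (I : Type) (f g : I * I -> K) (pq : (I * I) * (I * I)) : K :=
  f (pq.1.1, pq.2.1) * g (pq.1.2, pq.2.2).

Definition midswap (I : Type) (pq : (I * I) * (I * I)) : (I * I) * (I * I) :=
  ((pq.1.1, pq.2.1), (pq.1.2, pq.2.2)).

Lemma midswapK (I : Type) : involutive (@midswap I).
Proof. by case=> [[a b] [c d]]. Qed.

Lemma midswap_bij (I : Type) : bijective (@midswap I).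
Proof. exact: inv_bij (@midswapK I). Qed.

Lemma lform_shuffle t I (f g : I * I -> K) :
  lform t f -> lform t g -> lform t (shuffle f g).
Proof.
case: t => //= hf hg.
exact: (null_inj (bij_inj (@midswap_bij I)) (null_tens hf hg)).
Qed.

Lemma pull_shuffle I J (M : I -> J -> K) (f g : J * J -> K) :
  (forall i, null (M i)) ->
  pull (tmor (tmor M M) (tmor M M)) (shuffle f g) =
  shuffle (pull (tmor M M) f) (pull (tmor M M) g).
Proof.
move=> hM; apply: funext => -[[p1 p2] [q1 q2]].
have hMM i i' (h : J * J -> K) : null (fun jj => M i jj.1 * M i' jj.2 * h jj).
  exact/null_mulr/(null_tens (hM i) (hM i')).
rewrite /shuffle /pull /tmor /= ssumM; [|exact: hMM..].
rewrite (ssum_reindex _ (@midswap_bij J)).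
by apply: eq_ssum => -[[a b] [c d]] /=; ring.
Qed.

End Matrices.

(** * Convolution of bilinear forms, for both kinds of topology *)

Section Convolution.
Variables (k : fieldType) (t : top_kind) (H : thopf k t).
Local Notation K := (fps k).
Local Notation I := (hidx H).
Implicit Types (f g : I * I -> K) (x y : I -> K).

Lemma lmor_cop2 : lmor t (tmor (@hcop _ _ H) (@hcop _ _ H)).
Proof. by apply: lmor_tmor; apply: hcop_cont. Qed.

Lemma vec_hcopr x : vec t x -> vec t (hcopr x).
Proof. by move=> hx; apply: vec_app hx (@hcop_cont _ _ H). Qed.

Lemma lform_conv1 : lform t (conv1 (H := H)).
Proof. by apply: lform_tens; apply: hcou_cont. Qed.

(** By conversion, [conv f g] is the pullback of [shuffle f g] along [tmor hcop hcop]. *)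
Lemma lform_conv f g : lform t f -> lform t g -> lform t (conv f g).
Proof. by move=> hf hg; apply/(lform_pull lmor_cop2)/lform_shuffle. Qed.

Lemma convpowS f n : convpow f n.+1 = conv f (convpow f n).
Proof. by []. Qed.

Lemma lform_convpow f n : lform t f -> lform t (convpow f n).
Proof.
by move=> hf; elim: n => [|n IHn]; [apply: lform_conv1 | apply: lform_conv].
Qed.

Lemma bev_conv f g x y : lform t f -> lform t g -> vec t x -> vec t y ->
  bev (conv f g) x y = ev (shuffle f g) (tens (hcopr x) (hcopr y)).
Proof.
move=> hf hg hx hy; rewrite -(app_tens_kind hx hy (hcop_cont H) (hcop_cont H)).
by rewrite (ev_app_kind (vec_tens hx hy) lmor_cop2)//; apply: lform_shuffle.
Qed.

Lemma convZ f g c d : lform t f -> lform t g ->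
  conv (fun p => c * f p) (fun p => d * g p) = (fun p => c * d * conv f g p).
Proof.
move=> hf hg; apply: funext => -[a b]; rewrite /conv -ssumZ.
  by apply: eq_ssum => -[p q] /=; ring.
apply: null_mull.
exact: (null_lmor_lform (a, b) lmor_cop2 (lform_shuffle hf hg)).
Qed.

Lemma convpowZ f c n : lform t f ->
  convpow (fun p => c * f p) n = (fun p => c ^+ n * convpow f n p).
Proof.
move=> hf; elim: n => [|n IHn]; first by apply: funext => p; rewrite mul1r.
rewrite convpowS IHn convZ//; last exact: lform_convpow.
by rewrite exprS.
Qed.

End Convolution.

(** * Jointly null matrices, and pairings with series *)

Section JointlyNull.
Variable k : fieldType.
Local Notation K := (fps k).
Implicit Types I J N : choiceType.

(** Decay in both indices at once: arbitrary vectors are sent to null ones, arbitrary forms are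
    pulled back to null ones, and evaluation commutes with the map ([ev_app_jnull]). *)
Definition jnull (I J : Type) (M : I -> J -> K) : Prop :=
  null (fun p : I * J => M p.1 p.2).

Lemma ph_jnull I J (M : I -> J -> K) : ph_continuous M -> jnull M.
Proof. by case=> hM hfin; apply: null_uncurry. Qed.

Lemma jnull_row I J (M : I -> J -> K) i : jnull M -> null (M i).
Proof. exact: null_fiberr. Qed.

Lemma jnull_col I J (M : I -> J -> K) j : jnull M -> null (fun i => M i j).
Proof. exact: (@null_fiberl _ _ _ (fun p => M p.1 p.2)). Qed.

Lemma jnull_tmor I J I' J' (M : I -> J -> K) (N : I' -> J' -> K) :
  jnull M -> jnull N -> jnull (tmor M N).
Proof.
move=> hM hN; apply: (null_inj (f := fun p : (I * I') * (J * J') =>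
  ((p.1.1, p.2.1), (p.1.2, p.2.2))) _ (null_tens hM hN)).
by move=> [[? ?] [? ?]] [[? ?] [? ?]] [-> -> -> ->].
Qed.

Lemma null_app_jnull I J (M : I -> J -> K) x : jnull M -> null (app M x).
Proof.
move=> hM; apply: (null_ssum (x := fun j i => x i * M i j)).
exact: (null_swap (null_mull (fun p : I * J => x p.1) hM)).
Qed.

Lemma null_pull_jnull I J (M : I -> J -> K) f : jnull M -> null (pull M f).
Proof.
move=> hM; apply: (null_ssum (x := fun i j => M i j * f j)).
exact: (null_mulr (fun p : I * J => f p.2) hM).
Qed.

Lemma ev_app_jnull I J (M : I -> J -> K) x f : jnull M ->
  ev f (app M x) = ev (pull M f) x.
Proof. by move=> hM; apply: ev_app; apply/null_mulr/null_mull. Qed.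

Lemma app_tens_jnull I J I' J' (M : I -> J -> K) (N : I' -> J' -> K) x y :
  jnull M -> jnull N -> app (tmor M N) (tens x y) = tens (app M x) (app N y).
Proof.
move=> hM hN; apply: app_tens => j; apply: null_mull; first exact: jnull_col hM.
exact: jnull_col hN.
Qed.

(** Joint nullity comes from [C] in the index [n] and from each [u n] in the index [i], so the
    weight [w] can be arbitrary, for instance a row of a coproduct of F. *)
Lemma ssum_series N I (C : N -> K) (u : N -> I -> K) (w : I -> K) :
  null C -> (forall n, null (u n)) ->
  ssum (fun i => w i * ssum (fun n => C n * u n i)) =
  ssum (fun n => C n * ssum (fun i => w i * u n i)).
Proof.
move=> hC hu; have hCu := null_dep hC hu.
transitivity (ssum (fun i => ssum (fun n => w i * (C n * u n i)))).
  apply: eq_ssum => i; rewrite -ssumZ//.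
  by apply/null_mull/null_mulr.
rewrite -ssum_exchange; last first.
  exact: (null_mull (fun p : N * I => w p.2) hCu).
apply: eq_ssum => n; rewrite -ssumZ; last by apply/null_mull/null_mull.
by apply: eq_ssum => i; ring.
Qed.

Lemma vec_row t I J (M : I -> J -> K) i : lmor t M -> vec t (M i).
Proof. by case: t => //= hM; apply: hM. Qed.

Definition fixr I J (f : I * J -> K) (y : J -> K) : I -> K :=
  fun r => ssum (fun s => f (r, s) * y s).
Definition fixl I J (f : I * J -> K) (x : I -> K) : J -> K :=
  fun s => ssum (fun r => f (r, s) * x r).

Lemma lform_fixr t I J (f : I * J -> K) y : lform t f -> lform t (fixr f y).
Proof.
case: t => //= hf; apply: (null_ssum (x := fun r s => f (r, s) * y s)).
by apply: null_mulr; apply: eq_null hf => -[].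
Qed.

Lemma lform_fixl t I J (f : I * J -> K) x : lform t f -> lform t (fixl f x).
Proof.
case: t => //= hf; apply: (null_ssum (x := fun s r => f (r, s) * x r)).
by apply: null_mulr; apply: null_swap.
Qed.

End JointlyNull.

(** * Bilinear forms with one argument fixed *)

Section Partial.
Variables (k : fieldType) (t : top_kind) (H : thopf k t).
Local Notation K := (fps k).
Local Notation I := (hidx H).
Implicit Types (f : I * I -> K) (x y : I -> K).

Lemma bev_pair f x y :
  bev f x y = ssum (fun p : I * I => f (p.1, p.2) * (x p.1 * y p.2)).
Proof. by apply: eq_ssum => -[]. Qed.

Lemma null_bev f x y : lform t f -> vec t x -> vec t y ->
  null (fun p : I * I => f (p.1, p.2) * (x p.1 * y p.2)).
Proof.
move=> hf hx hy; have := null_vec_lform (vec_tens hx hy) hf.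
by apply: eq_null => -[].
Qed.

Lemma bev_fixr f x y : lform t f -> vec t x -> vec t y ->
  bev f x y = ev (fixr f y) x.
Proof.
move=> hf hx hy; have h := null_bev hf hx hy.
rewrite bev_pair (ssum_pair (x := fun r s => f (r, s) * (x r * y s)))//.
apply: eq_ssum => r; rewrite /fixr -ssumZr; first by apply: eq_ssum => s; ring.
by apply: eq_null (null_fiberr r h) => s /=; ring.
Qed.

Lemma bev_fixl f x y : lform t f -> vec t x -> vec t y ->
  bev f x y = ev (fixl f x) y.
Proof.
move=> hf hx hy; have h := null_bev hf hx hy.
rewrite bev_pair (ssum_pair (x := fun r s => f (r, s) * (x r * y s)))//.
rewrite ssum_exchange//; apply: eq_ssum => s; rewrite /fixl -ssumZr.
  by apply: eq_ssum => r; ring.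
by apply: eq_null (null_fiberl s h) => r /=; ring.
Qed.

End Partial.

(** * The two members of the cocycle identity as evaluations of a form *)

Section Cocycles.
Variables (k : fieldType) (t : top_kind) (H : thopf k t).
Local Notation K := (fps k).
Local Notation I := (hidx H).
Implicit Types (f g : I * I -> K) (x y : I -> K).

(** The factor g(a_(2) b_(2), c), seen as a bilinear form in the two multiplied arguments; this
    turns a member of the cocycle identity into a [shuffle]. *)
Definition lmul_form g c : I * I -> K := fun pq => bev g (@hmulc _ _ H pq) c.
Definition rmul_form g a : I * I -> K := fun pq => bev g a (@hmulc _ _ H pq).

Lemma coclE f g a b c :
  cocl f g a b c = ev (shuffle f (lmul_form g c)) (tens (hcopr a) (hcopr b)).
Proof. by apply: eq_ssum => pq; rewrite mulrC. Qed.

Lemma cocrE f g a b c :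
  cocr f g a b c = ev (shuffle f (rmul_form g a)) (tens (hcopr b) (hcopr c)).
Proof. by apply: eq_ssum => pq; rewrite mulrC. Qed.

Lemma lmul_form_pull g c : lform t g -> vec t c ->
  lmul_form g c = pull (@hmulc _ _ H) (fixr g c).
Proof.
move=> hg hc; apply: funext => p; rewrite /lmul_form (bev_fixr hg)//.
  by apply: eq_ssum => i; rewrite mulrC.
exact: (vec_row p (hmulc_cont H)).
Qed.

Lemma rmul_form_pull g a : lform t g -> vec t a ->
  rmul_form g a = pull (@hmulc _ _ H) (fixl g a).
Proof.
move=> hg ha; apply: funext => p; rewrite /rmul_form (bev_fixl hg)//.
  by apply: eq_ssum => i; rewrite mulrC.
exact: (vec_row p (hmulc_cont H)).
Qed.

Lemma lform_lmul_form g c : lform t g -> vec t c -> lform t (lmul_form g c).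
Proof.
by move=> hg hc; rewrite lmul_form_pull//; apply/(lform_pull (hmulc_cont H))/lform_fixr.
Qed.

Lemma lform_rmul_form g a : lform t g -> vec t a -> lform t (rmul_form g a).
Proof.
by move=> hg ha; rewrite rmul_form_pull//; apply/(lform_pull (hmulc_cont H))/lform_fixl.
Qed.

Lemma bevZ f c x y : lform t f -> vec t x -> vec t y ->
  bev (fun p => c * f p) x y = c * bev f x y.
Proof. by move=> hf hx hy; apply/evZl/(null_vec_lform (vec_tens hx hy) hf). Qed.

Lemma coclZ f g u v a b c : lform t f -> lform t g ->
  vec t a -> vec t b -> vec t c ->
  cocl (fun p => u * f p) (fun p => v * g p) a b c = u * v * cocl f g a b c.
Proof.
move=> hf hg ha hb hc; rewrite !coclE.
have -> : shuffle (fun p => u * f p) (lmul_form (fun p => v * g p) c) =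
    (fun pq => u * v * shuffle f (lmul_form g c) pq).
  apply: funext => pq; rewrite /shuffle /lmul_form bevZ//; first ring.
  exact: (vec_row _ (hmulc_cont H)).
apply/evZl/(null_vec_lform (t := t)); first by apply: vec_tens; apply: vec_hcopr.
exact/lform_shuffle/lform_lmul_form.
Qed.

Lemma cocrZ f g u v a b c : lform t f -> lform t g ->
  vec t a -> vec t b -> vec t c ->
  cocr (fun p => u * f p) (fun p => v * g p) a b c = u * v * cocr f g a b c.
Proof.
move=> hf hg ha hb hc; rewrite !cocrE.
have -> : shuffle (fun p => u * f p) (rmul_form (fun p => v * g p) a) =
    (fun pq => u * v * shuffle f (rmul_form g a) pq).
  apply: funext => pq; rewrite /shuffle /rmul_form bevZ//; first ring.
  exact: (vec_row _ (hmulc_cont H)).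
apply/evZl/(null_vec_lform (t := t)); first by apply: vec_tens; apply: vec_hcopr.
exact/lform_shuffle/lform_rmul_form.
Qed.

End Cocycles.

(** * Forms pulled back along a morphism *)
Section Pullback.
Variables (k : fieldType) (U : thopf k TopFree) (F : thopf k TopProd).
Variable j : hidx F -> hidx U -> fps k.
Hypothesis (jph : ph_continuous j) (jhopf : hopf_map j).
Local Notation K := (fps k).
Local Notation B := (hidx U).
Local Notation E := (hidx F).
Implicit Types (f g : B * B -> K) (a b c : E -> K).

Definition pull2 f : E * E -> K := pull (tmor j j) f.

Let jn : jnull j. Proof. exact: ph_jnull. Qed.
Let jjn : jnull (tmor j j). Proof. exact: jnull_tmor. Qed.

Lemma lform_pull2 f : lform TopProd (pull2 f).
Proof. exact: null_pull_jnull. Qed.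

Lemma bev_pull2 f a b : bev f (app j a) (app j b) = bev (pull2 f) a b.
Proof. by rewrite /bev -app_tens_jnull// ev_app_jnull. Qed.

Lemma pull2E f e e' : pull2 f (e, e') = bev f (j e) (j e').
Proof. by apply: eq_ssum => p; rewrite mulrC. Qed.

Lemma hcopr_app a : hcopr (app j a) = app (tmor j j) (hcopr a).
Proof. by case: jhopf. Qed.

(** A coalgebra map pulls convolutions back to convolutions. The indices are rewritten as basis
    vectors because [hcopr_app] concerns images under [app j]. *)
Lemma pull2_conv f g : pull2 (conv f g) = conv (pull2 f) (pull2 g).
Proof.
apply: funext => -[e e']; rewrite pull2E -[j e]app_idmor -[j e']app_idmor.
rewrite bev_conv//=; [|exact: null_app_jnull..].
rewrite !hcopr_app -app_tens_jnull// ev_app_jnull; last exact: jnull_tmor.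
rewrite pull_shuffle; last by move=> i; apply: jnull_row jn.
by rewrite /hcopr !app_idmor; apply: eq_ssum => pq; rewrite mulrC.
Qed.

Lemma pull2_conv1 : pull2 (conv1 (H := U)) = conv1 (H := F).
Proof.
rewrite /pull2 pull_tens; try by move=> i; apply: null_mulr; apply: jnull_row jn.
have -> // : pull j (@hcou _ _ U) = @hcou _ _ F.
apply: funext => e; have [_ _ _ /(_ (@idmor k _ e)) + _] := jhopf.
rewrite /hcounit ev_idmor app_idmor => <-.
by apply: eq_ssum => p; rewrite mulrC.
Qed.

Lemma pull2_convpow f n : pull2 (convpow f n) = convpow (pull2 f) n.
Proof.
elim: n => [|n IHn]; first exact: pull2_conv1.
by rewrite !convpowS pull2_conv IHn.
Qed.

Lemma app_hmulc e e' : app j (@hmulc _ _ F (e, e')) = hmul (j e) (j e').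
Proof.
have [/(_ (@idmor k _ e) (@idmor k _ e')) + _ _ _ _] := jhopf.
by rewrite /hmul /bmul tens_idmor !app_idmor.
Qed.

Lemma pull2_pull_hmulc (f : B -> K) e e' :
  pull2 (pull (@hmulc _ _ U) f) (e, e') = ev f (app j (@hmulc _ _ F (e, e'))).
Proof.
rewrite pull2E app_hmulc /hmul /bmul.
rewrite (ev_app_kind (t := TopFree)) //; last exact: (hmulc_cont U).
by apply: null_tens; apply: jnull_row jn.
Qed.

(** Here the multiplicativity of [j] enters, through [app_hmulc]. *)
Lemma pull2_lmul_form g c : pull2 (lmul_form g (app j c)) = lmul_form (pull2 g) c.
Proof.
have hc : vec TopFree (app j c) by apply: null_app_jnull.
apply: funext => -[e e']; rewrite lmul_form_pull// pull2_pull_hmulc.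
by rewrite /lmul_form -bev_pull2 (@bev_fixr _ TopFree)//; apply: null_app_jnull.
Qed.

Lemma pull2_rmul_form g a : pull2 (rmul_form g (app j a)) = rmul_form (pull2 g) a.
Proof.
have ha : vec TopFree (app j a) by apply: null_app_jnull.
apply: funext => -[e e']; rewrite rmul_form_pull// pull2_pull_hmulc.
by rewrite /rmul_form -bev_pull2 (@bev_fixl _ TopFree)//; apply: null_app_jnull.
Qed.

Lemma ev_shuffle_app f g (x y : E * E -> K) :
  ev (shuffle f g) (tens (app (tmor j j) x) (app (tmor j j) y)) =
  ev (shuffle (pull2 f) (pull2 g)) (tens x y).
Proof.
rewrite -app_tens_jnull// ev_app_jnull; last exact: jnull_tmor.
by rewrite pull_shuffle// => i; apply: jnull_row jn.
Qed.

Lemma cocl_pull2 f g a b c :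
  cocl f g (app j a) (app j b) (app j c) = cocl (pull2 f) (pull2 g) a b c.
Proof. by rewrite !coclE !hcopr_app ev_shuffle_app pull2_lmul_form. Qed.

Lemma cocr_pull2 f g a b c :
  cocr f g (app j a) (app j b) (app j c) = cocr (pull2 f) (pull2 g) a b c.
Proof. by rewrite !cocrE !hcopr_app ev_shuffle_app pull2_rmul_form. Qed.

End Pullback.

(** * The convolution algebra of a coalgebra *)
Section Coalgebra.
Variables (k : fieldType) (C : choiceType).
Local Notation K := (fps k).
Implicit Types (D : C -> C * C -> K) (f g h e : C -> K).

(** Convolution of linear forms. With pairs as indices and [D] the coproduct of a tensor square it
    becomes the convolution of bilinear forms, so that associativity and units need be proved for
    linear forms only. *)
Definition coconv D f g : C -> K := fun a => ssum (fun p => D a p * (f p.1 * g p.2)).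

(** The opposite coproduct exchanges the factors of a convolution: right-nested products and right
    units reduce to their mirror images. *)
Definition coop D : C -> C * C -> K := fun a p => D a (p.2, p.1).

Lemma coconv_coop D f g : coconv (coop D) f g = coconv D g f.
Proof.
apply: funext => a; rewrite /coconv.
rewrite [RHS](ssum_reindex (h := fun p : C * C => (p.2, p.1))).
  by apply: eq_ssum => -[p q]; rewrite /coop /= [g _ * _]mulrC.
by exists (fun p => (p.2, p.1)); case.
Qed.

Lemma null_coconv D f g : lmor TopProd D -> null f -> null g -> null (coconv D f g).
Proof.
move=> hD hf hg; exact: (lform_pull (t := TopProd) hD (null_tens hf hg)).
Qed.

(** The triple [T] is (r, (p, q)): [h] takes the leg r of the first coproduct, [f] and [g] take the
    legs p and q of the second. The inner sum over [x] is one side of coassociativity. *)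
Lemma coconv_expand D f g h a : lmor TopProd D -> null f -> null g -> null h ->
  coconv D (coconv D f g) h a =
  ssum (fun T : C * (C * C) => f T.2.1 * g T.2.2 * h T.1 *
    ssum (fun x => D a (x, T.1) * D x T.2)).
Proof.
move=> hD hf hg hh; pose w (T : C * (C * C)) := f T.2.1 * g T.2.2 * h T.1.
have hw : null w.
  apply: eq_null (null_tens hh (null_tens hf hg)) => T.
  by rewrite /tens /w mulrC.
have hN : null (fun p : C * (C * (C * C)) =>
    D a (p.1, p.2.1) * D p.1 p.2.2 * w p.2).
  apply: (null_dep_swap (M := fun x T => D a (x, T.1) * D x T.2)) hw _ => T.
  by apply: null_mull; apply: hD.
have hN1 x := null_fiberr x hN.
transitivity (ssum (fun x => ssum (fun T : C * (C * C) =>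
    D a (x, T.1) * D x T.2 * w T))); last first.
  rewrite (ssum_exchange (x := fun x T => D a (x, T.1) * D x T.2 * w T))//.
  apply: eq_ssum => T; rewrite -/(w T) mulrC ssumZr//.
  exact: (null_fiberl T hN).
rewrite /coconv (eq_ssum (y := fun p : C * C => D a (p.1, p.2) *
   (coconv D f g p.1 * h p.2))); last by case.
rewrite (ssum_pair (x := fun x r => D a (x, r) * (coconv D f g x * h r))); last first.
  exact/null_mull/(null_tens (null_coconv hD hf hg) hh).
apply: eq_ssum => x.
rewrite (eq_ssum (x := fun T : C * (C * C) => _)
  (y := fun T => D a (x, T.1) * D x T.2 * w (T.1, T.2))); last by case.
rewrite (ssum_pair (x := fun r q => D a (x, r) * D x q * w (r, q))); last first.
  by apply: eq_null (hN1 x) => -[].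
apply: eq_ssum => r; rewrite mulrCA /coconv -ssumZr; last first.
  exact/null_mulr/null_mull/null_tens.
apply: eq_ssum => q; rewrite /w /=; ring.
Qed.

Lemma coconvA D f g h : lmor TopProd D ->
  (forall a p q r, ssum (fun x => D a (x, r) * D x (p, q)) =
                   ssum (fun x => D a (p, x) * D x (q, r))) ->
  null f -> null g -> null h ->
  coconv D f (coconv D g h) = coconv D (coconv D f g) h.
Proof.
move=> hD DA hf hg hh; apply: funext => a.
(* In the opposite coalgebra f * (g * h) reads (h * g) * f, so the expansion of left-nested products
   serves on both sides. *)
rewrite -coconv_coop -[coconv D g h]coconv_coop.
have hD' : lmor TopProd (coop D) by case=> p q; apply: hD.
rewrite !coconv_expand//.
rewrite [RHS](ssum_reindex (h := fun T : C * (C * C) => (T.2.1, (T.1, T.2.2)))).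
  apply: eq_ssum => -[p [r q]] /=; rewrite DA; ring.
by exists (fun T => (T.2.1, (T.1, T.2.2))); case=> p [].
Qed.

Lemma coconv1l D e f : lmor TopProd D -> null e -> null f ->
  (forall a q, ssum (fun p => e p * D a (p, q)) = @idmor k C a q) ->
  coconv D e f = f.
Proof.
move=> hD he hf De; apply: funext => a.
have h : null (fun p : C * C => D a (p.1, p.2) * (e p.1 * f p.2)).
  exact/null_mull/null_tens.
rewrite /coconv (eq_ssum (y := fun p : C * C => D a (p.1, p.2) * (e p.1 * f p.2)));
  last by case.
rewrite (ssum_pair (x := fun p q => D a (p, q) * (e p * f q)))//.
rewrite ssum_exchange// -[RHS](ssum_idmorl f); apply: eq_ssum => q.
rewrite -De -ssumZr; first by apply: eq_ssum => p; ring.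
by apply: eq_null (null_fiberl q h) => p /=; ring.
Qed.

Lemma coconv1r D e f : lmor TopProd D -> null e -> null f ->
  (forall a q, ssum (fun p => e p * D a (q, p)) = @idmor k C a q) ->
  coconv D f e = f.
Proof.
by move=> hD he hf De; rewrite -coconv_coop coconv1l// => -[p q]; apply: hD.
Qed.

End Coalgebra.

(** * The convolution algebra of bilinear forms on a QFSHA-type module *)

Section ConvolutionAlgebra.
Variables (k : fieldType) (F : thopf k TopProd).
Local Notation K := (fps k).
Local Notation I := (hidx F).
Local Notation cop := (@hcop _ _ F).
Local Notation cou := (@hcou _ _ F).
Implicit Types (f g h : I * I -> K) (C : nat -> K) (u : nat -> I * I -> K).

(** The coproduct of the tensor square, for which [conv] is an instance of [coconv]. *)
Definition cop2 (ab : I * I) (PQ : (I * I) * (I * I)) : K :=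
  cop ab.1 (PQ.1.1, PQ.2.1) * cop ab.2 (PQ.1.2, PQ.2.2).

Lemma conv_coconv f g : conv f g = coconv cop2 f g.
Proof.
apply: funext => ab; rewrite /conv (ssum_reindex _ (@midswap_bij I)).
by apply: eq_ssum => -[[a b] [c d]].
Qed.

Lemma cop_col p q : null (fun a => cop a (p, q)).
Proof. exact: (hcop_cont F (p, q)). Qed.

Lemma cop2_cont : lmor TopProd cop2.
Proof. by case=> P Q; exact: (null_tens (cop_col _ _) (cop_col _ _)). Qed.

Lemma lmor_idmor t (J : choiceType) : lmor t (@idmor k J).
Proof.
case: t => /= i; first exact: null_idmor.
by apply: eq_null (null_idmor k i) => j; rewrite /idmor eq_sym.
Qed.

(** The axiom [hcopA] at the basis vector [a], in coordinates: in each member the identity factor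
    collapses one of the two summation indices. *)
Lemma copA a p q r :
  ssum (fun x => cop a (x, r) * cop x (p, q)) =
  ssum (fun x => cop a (p, x) * cop x (q, r)).
Proof.
have hi r' := @lmor_idmor TopProd I r'.
have hl : null (fun x : I * I => cop a (x.1, x.2) *
    (cop x.1 (p, q) * @idmor k I x.2 r)).
  exact: (null_mull _ (null_tens (cop_col p q) (hi r))).
have hr : null (fun x : I * I => cop a (x.1, x.2) *
    (@idmor k I x.1 p * cop x.2 (q, r))).
  exact: (null_mull _ (null_tens (hi p) (cop_col q r))).
have := @hcopA _ _ F (@idmor k I a) Logic.I p q r.
rewrite !app_idmor /app.
rewrite (eq_ssum (y := fun i : I * I => cop a (i.1, i.2) *
  (cop i.1 (p, q) * @idmor k I i.2 r))); last by case.
rewrite [X in _ = X -> _](eq_ssum (y := fun i : I * I => cop a (i.1, i.2) *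
  (@idmor k I i.1 p * cop i.2 (q, r)))); last by case.
rewrite (ssum_pair (x := fun x y => cop a (x, y) * (cop x (p, q) * @idmor k I y r)))//.
rewrite (ssum_pair (x := fun x y => cop a (x, y) * (@idmor k I x p * cop y (q, r))))//.
rewrite [X in _ = X -> _]ssum_exchange//.
congr (_ = _); apply: eq_ssum => x.
  rewrite (@ssum_supp1 _ _ _ r) /idmor ?eqxx ?mulr1// => y /negbTE ->.
  by rewrite !mulr0.
rewrite (@ssum_supp1 _ _ _ p) /idmor ?eqxx ?mul1r// => y /negbTE ->.
by rewrite mul0r mulr0.
Qed.

Lemma cop2A a p q r :
  ssum (fun x => cop2 a (x, r) * cop2 x (p, q)) =
  ssum (fun x => cop2 a (p, x) * cop2 x (q, r)).
Proof.
transitivity (ssum (fun x => cop a.1 (x, r.1) * cop x (p.1, q.1)) *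
              ssum (fun x => cop a.2 (x, r.2) * cop x (p.2, q.2))).
  rewrite ssumM; try exact/null_mull/cop_col.
  by apply: eq_ssum => x; rewrite /cop2 /=; ring.
rewrite !copA ssumM; try exact/null_mull/cop_col.
by apply: eq_ssum => x; rewrite /cop2 /=; ring.
Qed.

Lemma convA f g h : null f -> null g -> null h ->
  conv f (conv g h) = conv (conv f g) h.
Proof.
by move=> *; rewrite !conv_coconv coconvA//; [apply: cop2_cont | apply: cop2A].
Qed.

Lemma cop_coul a q : ssum (fun p => cou p * cop a (p, q)) = @idmor k I a q.
Proof.
by rewrite -[RHS](congr1 (@^~ q) (@hcoul _ _ F (@idmor k I a) Logic.I)) app_idmor.
Qed.

Lemma cop_cour a q : ssum (fun p => cou p * cop a (q, p)) = @idmor k I a q.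
Proof.
by rewrite -[RHS](congr1 (@^~ q) (@hcour _ _ F (@idmor k I a) Logic.I)) app_idmor.
Qed.

Lemma conv1l f : null f -> conv (conv1 (H := F)) f = f.
Proof.
move=> hf; rewrite conv_coconv coconv1l//; [exact: cop2_cont | exact: (lform_conv1 F) |].
case=> a b [p q]; rewrite -tens_idmor /tens /= -!cop_coul ssumM.
- by apply: eq_ssum => x; rewrite /cop2 /conv1 /tens /=; ring.
- exact: (null_mulr _ (hcou_cont F)).
exact: (null_mulr _ (hcou_cont F)).
Qed.

Lemma conv1r f : null f -> conv f (conv1 (H := F)) = f.
Proof.
move=> hf; rewrite conv_coconv coconv1r//; [exact: cop2_cont | exact: (lform_conv1 F) |].
case=> a b [p q]; rewrite -tens_idmor /tens /= -!cop_cour ssumM.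
- by apply: eq_ssum => x; rewrite /cop2 /conv1 /tens /=; ring.
- exact: (null_mulr _ (hcou_cont F)).
exact: (null_mulr _ (hcou_cont F)).
Qed.

Lemma null_convpow f n : null f -> null (convpow f n).
Proof. exact: (@lform_convpow _ TopProd). Qed.

Lemma null_shuffle f g : null f -> null g -> null (shuffle f g).
Proof. exact: (@lform_shuffle _ TopProd). Qed.

Lemma null_conv_terms f g ab : null f -> null g ->
  null (fun pq => tmor cop cop ab pq * shuffle f g pq).
Proof.
by move=> hf hg; apply/null_mull/null_shuffle.
Qed.

Lemma convDl f f' g : null f -> null f' -> null g ->
  conv (fun p => f p + f' p) g = (fun p => conv f g p + conv f' g p).
Proof.
move=> hf hf' hg; apply: funext => ab; rewrite -ssumD; try exact: null_conv_terms.
by apply: eq_ssum => pq; ring.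
Qed.

Lemma convDr f f' g : null f -> null f' -> null g ->
  conv g (fun p => f p + f' p) = (fun p => conv g f p + conv g f' p).
Proof.
move=> hf hf' hg; apply: funext => ab; rewrite -ssumD; try exact: null_conv_terms.
by apply: eq_ssum => pq; ring.
Qed.

Definition series C u : I * I -> K := fun p => ssum (fun n => C n * u n p).

Lemma null_series C u : null C -> (forall n, null (u n)) -> null (series C u).
Proof.
move=> hC hu; apply: (null_ssum (x := fun p n => C n * u n p)).
exact: (null_swap (null_dep hC hu)).
Qed.

Lemma conv_seriesr C u f : null C -> (forall n, null (u n)) -> null f ->
  conv f (series C u) = series C (fun n => conv f (u n)).
Proof.
move=> hC hu hf; apply: funext => ab.
rewrite -[RHS](ssum_series (u := fun n => shuffle f (u n)))//; last first.
  by move=> n; apply: null_shuffle.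
apply: eq_ssum => pq; congr (_ * _); rewrite /shuffle /series -ssumZ.
  by apply: eq_ssum => n; ring.
exact/null_mull/null_mulr.
Qed.

Lemma conv_seriesl C u f : null C -> (forall n, null (u n)) -> null f ->
  conv (series C u) f = series C (fun n => conv (u n) f).
Proof.
move=> hC hu hf; apply: funext => ab.
rewrite -[RHS](ssum_series (u := fun n => shuffle (u n) f))//; last first.
  by move=> n; apply: null_shuffle.
apply: eq_ssum => pq; congr (_ * _); rewrite /shuffle /series -ssumZr.
  by apply: eq_ssum => n; ring.
exact/null_mulr/null_mulr.
Qed.

Lemma convpowSr f n : null f -> convpow f n.+1 = conv (convpow f n) f.
Proof.
move=> hf; elim: n => [|n IHn]; first by rewrite convpowS conv1r// conv1l.
by rewrite convpowS [in LHS]IHn convA//; apply: null_convpow.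
Qed.

(* The inverse of 1 + h f is the geometric series of - h f. *)
Lemma conv_inverse f : null f -> exists s, [/\ null s,
  conv (fun p => conv1 (H := F) p + hbar * f p) s = conv1 (H := F) &
  conv s (fun p => conv1 (H := F) p + hbar * f p) = conv1 (H := F)].
Proof.
move=> hf; have h1 : null (conv1 (H := F)) by exact: (lform_conv1 F).
pose C n : K := hbar ^+ n * (-1) ^+ n.
have hC : null C by apply: null_hpow.
pose s := series C (convpow f); have hn n := null_convpow n hf.
have hs : null s by apply: null_series.
have hf' : null (fun p => hbar * f p) by apply: null_mull.
(* The fixed-point equation of the geometric series, obtained by splitting off the term n = 0. *)
have sE : s = (fun p => conv1 (H := F) p - hbar * conv f s p).
  rewrite conv_seriesr//; apply: funext => p; rewrite /s /series.
  rewrite ssum_nat_recl; last exact: null_mulr.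
  rewrite /C !expr0 !mul1r; congr (_ + _); rewrite -mulNr -ssumZ.
    by apply: eq_ssum => n; rewrite !exprS convpowS; ring.
  exact/null_mull/null_mulr.
(* [f] commutes with its own powers, hence with [s], which makes the inverse two-sided. *)
have sC : conv s f = conv f s.
  rewrite conv_seriesl// conv_seriesr//; congr series; apply: funext => n.
  by rewrite -convpowSr.
(* [convZ] scales both factors, so the scalar 1 is inserted on the other one. *)
have Zl g g' : null g -> null g' ->
    conv (fun p => hbar * g p) g' = (fun p => hbar * conv g g' p).
  move=> hg hg'; rewrite -[RHS](funext (fun p => congr1 ( *%R^~ _) (mulr1 hbar))).
  by rewrite -convZ//; congr conv; apply: funext => p; rewrite mul1r.
have Zr g g' : null g -> null g' ->
    conv g (fun p => hbar * g' p) = (fun p => hbar * conv g g' p).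
  move=> hg hg'; rewrite -[RHS](funext (fun p => congr1 ( *%R^~ _) (mul1r hbar))).
  by rewrite -convZ//; congr conv; apply: funext => p; rewrite mul1r.
exists s; split=> //.
  by rewrite convDl// conv1l// Zl//; apply: funext => p; rewrite {1}sE subrK.
by rewrite convDr// conv1r// Zr// sC; apply: funext => p; rewrite {1}sE subrK.
Qed.

End ConvolutionAlgebra.

(** * The convolution exponential: invertibility, normalisation, cocycle members *)

Section ConvolutionExponential.
Variables (k : fieldType) (F : thopf k TopProd).
Local Notation K := (fps k).
Local Notation I := (hidx F).
Implicit Types (f g : I * I -> K) (a b c x y : I -> K).

Definition expc n : K := (n`!%:R)^-1 * hbar ^+ n.

Lemma null_expc : null expc.
Proof.
by apply: eq_null (null_hpow (fun n => (n`!%:R)^-1)) => n; rewrite mulrC.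
Qed.

Lemma convexpE f : convexp f = series expc (convpow f).
Proof. by []. Qed.

Lemma null_convexp f : null f -> null (convexp f).
Proof.
by move=> hf; apply: (null_series null_expc) => n; apply: null_convpow.
Qed.

Section Series.
Variables (C D : nat -> K) (u v : nat -> I * I -> K).
Hypotheses (hC : null C) (hD : null D).
Hypotheses (hu : forall n, null (u n)) (hv : forall n, null (v n)).

Lemma bev_series x y :
  bev (series C u) x y = ssum (fun n => C n * bev (u n) x y).
Proof.
transitivity (ssum (fun p => tens x y p * ssum (fun n => C n * u n p))).
  by apply: eq_ssum => p; rewrite mulrC.
rewrite ssum_series//; apply: eq_ssum => n; congr (_ * _).
by apply: eq_ssum => p; rewrite mulrC.
Qed.

Lemma ev_shuffle_series (w : (I * I) * (I * I) -> K) :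
  ev (shuffle (series C u) (series D v)) w =
  ssum (fun nm : nat * nat => C nm.1 * D nm.2 * ev (shuffle (u nm.1) (v nm.2)) w).
Proof.
pose CD (nm : nat * nat) := C nm.1 * D nm.2.
transitivity (ssum (fun pq => w pq *
    ssum (fun nm => CD nm * shuffle (u nm.1) (v nm.2) pq))).
  apply: eq_ssum => pq; rewrite mulrC /shuffle /series ssumM; [|exact: null_mulr..].
  by congr (_ * _); apply: eq_ssum => nm; rewrite /CD; ring.
rewrite ssum_series; first last.
- by move=> nm; apply: null_shuffle.
- exact: (null_tens hC hD).
apply: eq_ssum => nm; congr (_ * _).
by apply: eq_ssum => pq; rewrite mulrC.
Qed.

End Series.

(** The member becomes a single sum over [nat * nat], the index set of [polar_cocl], which makes a
    termwise comparison possible. *)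
Lemma cocl_series C D (u v : nat -> I * I -> K) a b c : null C -> null D ->
  (forall n, null (u n)) -> (forall n, null (v n)) ->
  cocl (series C u) (series D v) a b c =
  ssum (fun nm : nat * nat => C nm.1 * D nm.2 * cocl (u nm.1) (v nm.2) a b c).
Proof.
move=> hC hD hu hv; rewrite coclE.
have -> : lmul_form (series D v) c = series D (fun n => lmul_form (v n) c).
  by apply: funext => p; rewrite /lmul_form bev_series.
rewrite ev_shuffle_series//; first by apply: eq_ssum => nm; rewrite coclE.
by move=> n; exact: (@lform_lmul_form k TopProd F (v n) c (hv n) Logic.I).
Qed.

Lemma cocr_series C D (u v : nat -> I * I -> K) a b c : null C -> null D ->
  (forall n, null (u n)) -> (forall n, null (v n)) ->
  cocr (series C u) (series D v) a b c =
  ssum (fun nm : nat * nat => C nm.1 * D nm.2 * cocr (u nm.1) (v nm.2) a b c).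
Proof.
move=> hC hD hu hv; rewrite cocrE.
have -> : rmul_form (series D v) a = series D (fun n => rmul_form (v n) a).
  by apply: funext => p; rewrite /rmul_form bev_series.
rewrite ev_shuffle_series//; first by apply: eq_ssum => nm; rewrite cocrE.
by move=> n; exact: (@lform_rmul_form k TopProd F (v n) a (hv n) Logic.I).
Qed.

Lemma convexp_inverse f : null f -> exists s, [/\ null s,
  conv (convexp f) s = conv1 (H := F) & conv s (convexp f) = conv1 (H := F)].
Proof.
move=> hf; have hn n := null_convpow n hf.
(* One h is taken out of the terms of positive degree: the exponential is 1 + h g, and
   [conv_inverse] applies. *)
pose C n : K := (n.+1`!%:R)^-1 * hbar ^+ n.
have hC : null C.
  by apply: eq_null (null_hpow (fun n => (n.+1`!%:R)^-1)) => n; rewrite mulrC.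
have hg : null (series C (fun n => convpow f n.+1)) by apply: null_series.
have -> : convexp f =
    (fun p => conv1 (H := F) p + hbar * series C (fun n => convpow f n.+1) p).
  apply: funext => p; rewrite convexpE /series ssum_nat_recl; last first.
    exact/null_mulr/null_expc.
  rewrite /expc fact0 invr1 !mul1r; congr (_ + _); rewrite -ssumZ.
    by apply: eq_ssum => n; rewrite /C exprS; ring.
  exact/null_mull/null_mulr.
exact: conv_inverse.
Qed.

Lemma hcopr_one : hcopr (@hone _ _ F) = tens (@hone _ _ F) (@hone _ _ F).
Proof. exact: hcop1. Qed.

(** As 1 is grouplike, (f * g)(a, 1) = f(a_(1), 1) g(a_(2), 1). With g a power of f, this kills all
    positive degrees of the exponential. *)
Lemma bev_conv_one f g a : null f -> null g ->
  (forall x, bev f x (@hone _ _ F) = 0) -> bev (conv f g) a (@hone _ _ F) = 0.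
Proof.
move=> hf hg f1; rewrite (@bev_conv _ TopProd)// hcopr_one.
have fix0 : fixr f (@hone _ _ F) = fun=> 0.
  apply: funext => i; rewrite -ev_idmor -(@bev_fixr _ TopProd)//.
have h : null (fun pq : (I * I) * (I * I) => (hcopr a pq.1 *
    (f (pq.1.1, pq.2.1) * hone pq.2.1)) * (g (pq.1.2, pq.2.2) * hone pq.2.2)).
  apply: eq_null (null_mulr (fun pq => hcopr a pq.1 * (hone pq.2.1 * hone pq.2.2))
    (null_shuffle hf hg)) => pq.
  by rewrite /shuffle; ring.
transitivity (ssum (fun p : I * I => ssum (fun q : I * I => (hcopr a p *
    (f (p.1, q.1) * hone q.1)) * (g (p.2, q.2) * hone q.2)))).
  rewrite -(ssum_pair h); apply: eq_ssum => pq; rewrite /shuffle /tens; ring.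
rewrite -[RHS](@ssum0 k (I * I)%type); apply: eq_ssum => -[p1 p2].
transitivity (hcopr a (p1, p2) * fixr f (@hone _ _ F) p1 * fixr g (@hone _ _ F) p2).
  rewrite -mulrA /fixr ssumM; [|exact/null_mulr/null_fiberr..].
  rewrite -ssumZ; first by apply: eq_ssum => q /=; ring.
  by apply: eq_null (null_fiberr (p1, p2) h) => q /=; ring.
by rewrite fix0 mulr0 mul0r.
Qed.

Lemma bev_one_conv f g a : null f -> null g ->
  (forall x, bev f (@hone _ _ F) x = 0) -> bev (conv f g) (@hone _ _ F) a = 0.
Proof.
move=> hf hg f1; rewrite (@bev_conv _ TopProd)// hcopr_one.
have fix0 : fixl f (@hone _ _ F) = fun=> 0.
  by apply: funext => i; rewrite -ev_idmor -(@bev_fixl _ TopProd).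
have h : null (fun qp : (I * I) * (I * I) => (hcopr a qp.1 *
    (f (qp.2.1, qp.1.1) * hone qp.2.1)) * (g (qp.2.2, qp.1.2) * hone qp.2.2)).
  apply: eq_null (null_mulr (fun qp => hcopr a qp.1 * (hone qp.2.1 * hone qp.2.2))
    (null_swap (null_shuffle hf hg))) => qp.
  by rewrite /shuffle; ring.
transitivity (ssum (fun q : I * I => ssum (fun p : I * I => (hcopr a q *
    (f (p.1, q.1) * hone p.1)) * (g (p.2, q.2) * hone p.2)))).
  rewrite -(ssum_pair h) (ssum_reindex (h := fun qp : (I * I) * (I * I) => (qp.2, qp.1))).
    by apply: eq_ssum => qp; rewrite /shuffle /tens /=; ring.
  by exists (fun qp => (qp.2, qp.1)); case.
rewrite -[RHS](@ssum0 k (I * I)%type); apply: eq_ssum => -[q1 q2].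
transitivity (hcopr a (q1, q2) * fixl f (@hone _ _ F) q1 * fixl g (@hone _ _ F) q2).
  rewrite -mulrA /fixl ssumM; [|exact/null_mulr/null_fiberl..].
  rewrite -ssumZ; first by apply: eq_ssum => p /=; ring.
  by apply: eq_null (null_fiberr (q1, q2) h) => p /=; ring.
by rewrite fix0 mulr0 mul0r.
Qed.

Lemma bev_conv1 x y : bev (conv1 (H := F)) x y = hcounit x * hcounit y.
Proof. by apply: ev_tens; apply: null_mulr; exact: (hcou_cont F). Qed.

Lemma counit_one : hcounit (@hone _ _ F) = 1.
Proof. exact: hcou1. Qed.

Lemma bev_convexp_one f a : null f ->
  (forall x, bev f x (@hone _ _ F) = 0) -> bev (convexp f) a (@hone _ _ F) = hcounit a.
Proof.
move=> hf f1; rewrite convexpE (bev_series null_expc); last first.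
  by move=> n; apply: null_convpow.
rewrite (@ssum_supp1 _ _ _ 0%N) => [|[|n]//]; last first.
  by rewrite convpowS bev_conv_one ?mulr0//; apply: null_convpow.
by rewrite bev_conv1 counit_one mulr1 /expc invr1 !mul1r.
Qed.

Lemma bev_one_convexp f a : null f ->
  (forall x, bev f (@hone _ _ F) x = 0) -> bev (convexp f) (@hone _ _ F) a = hcounit a.
Proof.
move=> hf f1; rewrite convexpE (bev_series null_expc); last first.
  by move=> n; apply: null_convpow.
rewrite (@ssum_supp1 _ _ _ 0%N) => [|[|n]//]; last first.
  by rewrite convpowS bev_one_conv ?mulr0//; apply: null_convpow.
by rewrite bev_conv1 counit_one mul1r /expc invr1 !mul1r.
Qed.

End ConvolutionExponential.

(** * Factorials and powers of h in k((h)) *)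

Section Scalars.
Variables (k : fieldType).
Hypothesis char0 : [pchar k] =i pred0.
Local Notation K := (fps k).

(** The constant coefficient is n, nonzero in characteristic 0. In [fps] the inverse of a non-unit
    is itself by convention, so this is what lets [tofrac] commute with inverting n!. *)
Lemma fps_nat_unit n : (0 < n)%N -> (n%:R : K) \is a GRing.unit.
Proof.
move=> n0; have e : forall m, fcoef (m%:R : K) 0 = m%:R.
  by elim=> // m IHm; rewrite -!natr1 fcoefD IHm.
rewrite -[_ \is a _]/(fcoef (n%:R : K) 0 != 0) e.
by rewrite (pcharf0P k).1// -lt0n.
Qed.

Lemma tofrac_invn n : (0 < n)%N -> tofrac (n%:R : K)^-1 = (n%:R)^-1.
Proof. by move=> /fps_nat_unit u; rewrite rmorphV// rmorph_nat. Qed.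

Lemma tofrac_hbar_neq0 : tofrac (hbar : K) != 0.
Proof. by rewrite tofrac_eq0 hbar_neq0. Qed.

(** The sign of the exponent changes here: h^-n, against the h^(2n) released by the n-th power,
    leaves h^n. *)
Lemma tofrac_expc n x :
  (n`!%:R)^-1 * tofrac hbar ^- n * tofrac ((hbar ^+ 2) ^+ n * x) =
  tofrac (expc k n * x).
Proof.
rewrite /expc !tofracM tofrac_invn ?fact_gt0// -!tofracXn -!mulrA; congr (_ * _).
rewrite mulrA; congr (_ * _); rewrite -exprM mul2n -addnn exprD.
by rewrite tofracM mulKf// tofracXn expf_neq0// tofrac_hbar_neq0.
Qed.

End Scalars.

(** * Polar cocycles *)
Section PrimeElements.
Variables (k : fieldType) (U : thopf k TopFree).
Local Notation K := (fps k).
Local Notation B := (hidx U).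
Local Notation one := (@hone _ _ U).
Implicit Types (x y : B -> K) (f : B * B -> K).

(** [itercop] ends with the counit on its last leg, so the case of one leg is the right counit
    axiom. *)
Lemma itercop1 b (s : 1.-tuple B) : itercop b s = @idmor k B b (thead s).
Proof.
rewrite -(congr1 (@^~ (thead s)) (@hcour _ _ U (@idmor k B b) (null_idmor k b))).
by rewrite app_idmor; apply: eq_ssum => c; rewrite mulrC.
Qed.

Lemma delta1E x c : null x ->
  delta (n := 1) x [tuple c] = x c - hcounit x * one c.
Proof.
move=> hx; have hs : bijective (fun b : B => [tuple b] : 1.-tuple B).
  exists (fun s => thead s) => // s; apply: val_inj => /=.
  by case: s => [[|b [|b' s]]].
rewrite /delta [LHS](ssum_reindex _ hs).
transitivity (ssum (fun b => @idmor k B c b * x b + - one c * (@hcou _ _ U b * x b))).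
  apply: eq_ssum => b; rewrite big_ord1 /augproj !(tnth_nth b) /=.
  have -> : app (@itercop k U 1) x [tuple b] = x b.
    rewrite -[RHS](ssum_idmorl x); apply: eq_ssum => b'.
    by rewrite itercop1 mulrC /idmor eq_sym.
  by rewrite /idmor eq_sym; ring.
have hex : null (fun b => @hcou _ _ U b * x b) by apply: null_mull.
rewrite ssumD; [|exact: null_mull..].
by rewrite ssum_idmorl ssumZ ?mulNr 1?mulrC//; apply: null_mull.
Qed.

(** The defining condition at n = 1 puts x - epsilon(x) 1 in hU, and dividing this null family by h
    keeps it null. *)
Lemma prime_eltE x : prime_elt x ->
  exists2 x', null x' & x = (fun b => hcounit x * one b + hbar * x' b).
Proof.
move=> [hx /(_ 1%N) h1]; pose y b := x b - hcounit x * one b.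
have hy b : y b = hbar * hshift 1 (y b).
  by apply: (@hdvd_shift k 1); rewrite /y -delta1E//; apply: h1.
exists (fun b => hshift 1 (y b)).
  apply: (@nullZI _ _ 1); apply: (eq_null hy).
  have : null (fun b => x b + - hcounit x * one b).
    by apply: nullD => //; apply: null_mull; exact: (hone_vec U).
  by apply: eq_null => b; rewrite mulNr.
by apply: funext => b; rewrite -hy /y addrC subrK.
Qed.

(** With x = epsilon(x) 1 + h x' and y = epsilon(y) 1 + h y', the normalisation removes each term
    containing a unit and leaves h^2 f(x', y'). *)
Lemma bev_prime_elt f x y :
  (forall z, null z -> bev f z one = 0 /\ bev f one z = 0) ->
  prime_elt x -> prime_elt y -> hdvd 2 (bev f x y).
Proof.
move=> f1 hx hy; have [x0 _] := hx; have h1 := hone_vec U.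
have [x' hx' ex] := prime_eltE hx; have [y' hy' ey] := prime_eltE hy.
have linr z c w w' : null z -> null w -> null w' ->
    bev f z (fun b => c * w b + hbar * w' b) = c * bev f z w + hbar * bev f z w'.
  move=> hz hw hw'; rewrite !(@bev_fixl _ TopFree)//; last first.
    by apply: nullD; apply: null_mull.
  rewrite evD; [|by apply/null_mull/null_mull..].
  by rewrite !evZ//; apply: null_mull.
have linl z c w w' : null z -> null w -> null w' ->
    bev f (fun b => c * w b + hbar * w' b) z = c * bev f w z + hbar * bev f w' z.
  move=> hz hw hw'; rewrite !(@bev_fixr _ TopFree)//; last first.
    by apply: nullD; apply: null_mull.
  rewrite evD; [|by apply/null_mull/null_mull..].
  by rewrite !evZ//; apply: null_mull.
rewrite ey linr// (f1 _ x0).1 mulr0 add0r ex linl// (f1 _ hy').2 mulr0 add0r.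
by exists (bev f x' y'); rewrite mulrA.
Qed.

End PrimeElements.

(** * The restriction of a polar cocycle to U' *)

Section PartA.
Variables (k : fieldType) (char0 : [pchar k] =i pred0).
Variables (U : thopf k TopFree) (F : thopf k TopProd).
Variables (j : hidx F -> hidx U -> fps k) (chi : hidx U * hidx U -> fps k).
Hypotheses (Fprime : is_drinfeld_prime j) (chi_polar : polar_cocycle chi).

Let jph : ph_continuous j. Proof. by case: Fprime. Qed.
Let jhopf : hopf_map j. Proof. by case: Fprime. Qed.

Definition rescaled_form p : fps k := hshift 2 (pull2 j chi p).

Lemma pull2_rescaled : pull2 j chi = (fun p => hbar ^+ 2 * rescaled_form p).
Proof.
apply: funext => -[e e']; apply: hdvd_shift; rewrite pull2E.
have [_ _ _ _ jprime] := Fprime; have [chi1 _] := chi_polar.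
(* Each row [j e] lies in U', being the image of a basis vector of F. *)
by apply: bev_prime_elt => //; apply/jprime; [exists (idmor k e) | exists (idmor k e')];
  rewrite app_idmor.
Qed.

Lemma null_rescaled : null rescaled_form.
Proof.
by apply: (@nullZI _ _ 2); rewrite -pull2_rescaled; apply: (lform_pull2 jph).
Qed.

Let null_pow n : null (convpow rescaled_form n).
Proof. exact/null_convpow/null_rescaled. Qed.

Lemma bev_chi a b :
  bev chi (app j a) (app j b) = hbar ^+ 2 * bev rescaled_form a b.
Proof.
rewrite (bev_pull2 jph) pull2_rescaled (@bevZ _ TopProd)//.
exact: null_rescaled.
Qed.

Lemma pull2_convpow_chi n : pull2 j (convpow chi n) =
  (fun p => (hbar ^+ 2) ^+ n * convpow rescaled_form n p).
Proof.
rewrite (pull2_convpow jph jhopf) pull2_rescaled (@convpowZ _ TopProd)//.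
exact: null_rescaled.
Qed.

Lemma polar_terms_rescaled a b n : polar_terms chi (app j a) (app j b) n =
  tofrac (expc k n * bev (convpow rescaled_form n) a b).
Proof.
rewrite /polar_terms (bev_pull2 jph) pull2_convpow_chi (@bevZ _ TopProd)//;
  last exact: null_pow.
exact: (tofrac_expc char0).
Qed.

Lemma tofrac_expc2 (n m : nat) (x : fps k) :
  (n`!%:R * m`!%:R)^-1 * tofrac hbar ^- (n + m) *
    tofrac ((hbar ^+ 2) ^+ n * (hbar ^+ 2) ^+ m * x) =
  tofrac (expc k n * expc k m * x).
Proof.
(* The instance x = 1 isolates the scalar of index [n]; the instance for [m] carries [x]. *)
have := tofrac_expc char0 n 1; rewrite !mulr1 => en.
rewrite -[X in _ = tofrac X]mulrA [RHS]tofracM -en -(tofrac_expc char0 m).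
rewrite !tofracM exprD !invfM.
(* Once the inverses are atoms, an identity of commutative rings remains. *)
by move: (_^-1) (_^-1) (_^-1) (_^-1) => u v w z; ring.
Qed.

Lemma polar_cocl_rescaled a b c nm :
  polar_cocl chi (app j a) (app j b) (app j c) nm =
  tofrac (expc k nm.1 * expc k nm.2 *
    cocl (convpow rescaled_form nm.1) (convpow rescaled_form nm.2) a b c).
Proof.
rewrite /polar_cocl (cocl_pull2 jph jhopf) !pull2_convpow_chi (@coclZ _ TopProd)//;
  try exact: null_pow.
exact: tofrac_expc2.
Qed.

Lemma polar_cocr_rescaled a b c nm :
  polar_cocr chi (app j a) (app j b) (app j c) nm =
  tofrac (expc k nm.1 * expc k nm.2 *
    cocr (convpow rescaled_form nm.1) (convpow rescaled_form nm.2) a b c).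
Proof.
rewrite /polar_cocr (cocr_pull2 jph jhopf) !pull2_convpow_chi (@cocrZ _ TopProd)//;
  try exact: null_pow.
exact: tofrac_expc2.
Qed.

Lemma convexp_rescaled_cocycle : two_cocycle (convexp rescaled_form).
Proof.
have hx := null_rescaled; have [chi1 chiC] := chi_polar.
have j1 : app j (@hone _ _ F) = @hone _ _ U by have [_ ->] := jhopf.
have hj a : null (app j a) by apply/null_app_jnull/ph_jnull.
have null2 := null_tens (null_expc k) (null_expc k).
split; first exact: null_convexp.
- by have [s [hs h1 h2]] := convexp_inverse hx; exists s.
- move=> a _; split.
    (* The rescaled form vanishes on the unit because h^2 times it is chi on images, and h^2 can be
       cancelled. *)
    apply: bev_convexp_one => // x; apply: (@hexpI k 2).
    by rewrite -bev_chi j1 mulr0 (chi1 _ (hj x)).1.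
  apply: bev_one_convexp => // x; apply: (@hexpI k 2).
  by rewrite -bev_chi j1 mulr0 (chi1 _ (hj x)).2.
(* The comparison moves to k((h)), where the polar identity is stated. On images of F the terms are
   null families of power series, so both members converge as [polar_cocycle] requires. *)
move=> a b c _ _ _; apply/eqP; rewrite -tofrac_eq; apply/eqP.
apply: (chiC (app j a) (app j b) (app j c)) => //.
  rewrite !convexpE cocl_series//; try exact: null_expc.
  by rewrite (funext (polar_cocl_rescaled a b c)); apply/lsum_to_ssum/null_mulr.
rewrite !convexpE cocr_series//; try exact: null_expc.
by rewrite (funext (polar_cocr_rescaled a b c)); apply/lsum_to_ssum/null_mulr.
Qed.

Lemma polar_terms_sum a b :
  lsum_to (polar_terms chi (app j a) (app j b))
    (tofrac (bev (convexp rescaled_form) a b)).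
Proof.
rewrite convexpE (bev_series (null_expc k))//.
rewrite (funext (polar_terms_rescaled a b)).
exact/lsum_to_ssum/null_mulr/null_expc.
Qed.

End PartA.

(** * Polar twists *)
Section TensorSquarePowers.
Variables (k : fieldType) (U : thopf k TopFree).
Local Notation K := (fps k).
Local Notation B := (hidx U).
Implicit Types x y : B * B -> K.

Lemma null_hpow2 x n : null x -> null (hpow2 x n).
Proof.
move=> hx; elim: n => [|n IHn]; first exact: null_tens (hone_vec U) (hone_vec U).
apply: (@vec_app _ TopFree _ _ (tens x (hpow2 x n))); first exact: null_tens.
by move=> p; apply: null_tens; apply: (hmulc_cont U).
Qed.

Lemma hpow2Z c x n : null x ->
  hpow2 (fun p => c * x p) n = (fun p => c ^+ n * hpow2 x n p).
Proof.
move=> hx; elim: n => [|n IHn]; first by apply: funext => p; rewrite mul1r.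
transitivity (hmul2 (fun p => c * x p) (hpow2 (fun p => c * x p) n)) => //.
rewrite IHn; apply: funext => p; rewrite exprS.
rewrite -[hpow2 x n.+1 p]/(hmul2 x (hpow2 x n) p) /hmul2 /bmul /app -ssumZ.
  by apply: eq_ssum => i; rewrite /tens; ring.
apply/null_mull/null_mulr/null_tens => //; exact: null_hpow2.
Qed.

End TensorSquarePowers.

(** * The exponent of a polar twist, seen in the dual QUEA *)

Section PartB.
Variables (k : fieldType) (char0 : [pchar k] =i pred0).
Variables (F : thopf k TopProd) (U : thopf k TopFree).
Variables (j : hidx F -> hidx U -> fps k) (phi : hidx F * hidx F -> fps k).
Variable Tw : hidx U * hidx U -> fps k.
Hypotheses (Uvee : is_drinfeld_vee j) (phi_polar : polar_twist j phi Tw).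
Local Notation K := (fps k).
Local Notation E := (hidx F).
Local Notation B := (hidx U).
Local Notation cou := (@hcou _ _ F).

Let jn : jnull j. Proof. by apply: ph_jnull; case: Uvee => _ []. Qed.
Let jhopf : hopf_map j. Proof. by case: Uvee => _ []. Qed.

Lemma ideal_pow0 n : ideal_pow n (fun _ : E => 0 : K).
Proof.
case: n => // n; exists 0%N, (fun _ _ => 0), (fun _ _ => 0); split; first by case.
by apply: funext => e; rewrite big_ord0.
Qed.

Lemma vee_lattice_counit0 (z : E -> K) : hcounit z = 0 -> vee_lattice (toL 1 z).
Proof.
move=> hz; exists 1%N, (fun i => if i == 1%N then z else fun=> 0); split.
  move=> i; have [->|_] := eqVneq i 1%N; last exact: ideal_pow0.
  (* z is the single product z 1, with z in I and 1 in I^0, the whole of F. *)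
  exists 1%N, (fun=> z), (fun=> @hone _ _ F); split.
    move=> _; split=> //; exists (fun=> 0), z; split=> //.
    by apply: funext => e; rewrite mulr0 add0r.
  by apply: funext => e; rewrite big_ord1 [hmul _ _]hmulx1.
apply: funext => e; rewrite !big_ord_recl big_ord0 /= addr0.
by rewrite {2}/toL tofrac0 mulr0 add0r.
Qed.

(** h^-1 z lies in the lattice that [j] maps into U, so h^-1 j(z) is some u in U. *)
Lemma app_counit0_dvd (z : E -> K) b : hcounit z = 0 -> hdvd 1 (app j z b).
Proof.
move=> hz; have [_ _ /(_ _ (toL 1 (app j z)) (vee_lattice_counit0 hz)) vee _ _] := Uvee.
have [|u _ /(congr1 (@^~ b))] := vee; first by exists 1%N, z.
rewrite /toL expr0 invr1 mul1r expr1 => ju; exists (u b).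
by apply/eqP; rewrite -tofrac_eq tofracM -ju mulVKf// tofrac_hbar_neq0.
Qed.

Lemma jE_dvd e b : hdvd 1 (j e b - cou e * @hone _ _ U b).
Proof.
(* The element e - epsilon(e) 1 of Ker(epsilon). *)
pose z e' : K := @idmor k E e e' + - cou e * @hone _ _ F e'.
have hcou x : null (fun i => cou i * x i) by apply: null_mulr; exact: (hcou_cont F).
have jcol := jnull_col b jn.
have -> : j e b - cou e * @hone _ _ U b = app j z b.
  have [_ <- _ _ _] := jhopf.
  transitivity (ssum (fun i =>
      @idmor k E e i * j i b + - cou e * (@hone _ _ F i * j i b))).
    rewrite ssumD; [|exact: null_mull|exact/null_mull/null_mull].
    by rewrite ssum_idmorl ssumZ ?mulNr//; apply/null_mull/null_mull.
  by apply: eq_ssum => i; rewrite /z; ring.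
apply: app_counit0_dvd; rewrite /hcounit /z evD// ?evZ// ev_idmor.
by have := counit_one F; rewrite /hcounit => ->; rewrite mulr1 subrr.
Qed.

(** As the counit of [x] is 0, subtracting its counit part from each row of [j] leaves the sum
    unchanged, and [jE_dvd] then applies to each term. *)
Lemma sum_j_dvd (x : E -> K) b :
  ssum (fun e => cou e * x e) = 0 -> hdvd 1 (ssum (fun e => x e * j e b)).
Proof.
move=> hx; have hcx : null (fun e => cou e * x e).
  by apply: null_mulr; exact: (hcou_cont F).
have hjx : null (fun e => x e * j e b) by apply/null_mull/jnull_col.
suff -> : ssum (fun e => x e * j e b) =
    ssum (fun e => x e * (j e b - cou e * @hone _ _ U b)).
  by apply: hdvd_ssum => e; apply/hdvdMl/jE_dvd.
transitivity (ssum (fun e => x e * j e b + - @hone _ _ U b * (cou e * x e))).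
  by rewrite ssumD ?ssumZ ?hx ?mulr0 ?addr0//; apply: null_mull.
by apply: eq_ssum => e; ring.
Qed.

(** The legs are treated one at a time. Since (id (x) epsilon)(phi) = 0, the element (id (x)
    j)(phi), with coordinates [A], is divisible by h. The quotient is again killed by the counit,
    and [j] on the remaining leg yields the second h. *)
Lemma app_phi_dvd p : hdvd 2 (app (tmor j j) phi p).
Proof.
case: p => b b'; have [[phi1 phi2] _ _ _] := phi_polar.
have jc b0 : null (fun e => j e b0) by apply: jnull_col.
have hcou : null cou by exact: (hcou_cont F).
pose A e := ssum (fun e' => phi (e, e') * j e' b').
have hA e : A e = hbar * hshift 1 (A e).
  by apply/(@hdvd_shift k 1)/sum_j_dvd; exact: (congr1 (@^~ e) phi1).
have null1 (x : E -> K) : null x ->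
    null (fun p : E * E => x p.1 * (phi (p.1, p.2) * j p.2 b')).
  move=> hx; apply: eq_null (null_mull (fun p => phi (p.1, p.2))
    (null_tens hx (jc b'))) => p.
  by rewrite /tens /=; ring.
have sumA (x : E -> K) : null x ->
    ssum (fun p : E * E => x p.1 * (phi (p.1, p.2) * j p.2 b')) =
    ssum (fun e => x e * A e).
  move=> hx; rewrite (ssum_pair (x := fun e e' => x e * (phi (e, e') * j e' b')));
    last exact: null1.
  by apply: eq_ssum => e; rewrite ssumZ//; apply/null_mull/null_mull.
have -> : app (tmor j j) phi (b, b') = hbar * ssum (fun e => hshift 1 (A e) * j e b).
  transitivity (ssum (fun e => j e b * A e)).
    rewrite -sumA//; apply: eq_ssum => -[e e']; rewrite /tmor /=; ring.
  rewrite -ssumZ; last exact/null_mull/null_mull.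
  by apply: eq_ssum => e; rewrite {1}hA; ring.
apply: (@hdvdM _ 1 1); first by exists 1; rewrite mulr1.
(* The counit of the quotient is 0 because h times it is: that product is the image under [j] of
   (epsilon (x) id)(phi) = 0. *)
apply: sum_j_dvd; apply: (@hexpI k 1); rewrite mulr0.
rewrite -ssumZ; last exact/null_mull/null_mulr.
transitivity (ssum (fun e => cou e * A e)).
  by apply: eq_ssum => e; rewrite [in RHS]hA; ring.
rewrite -sumA// (ssum_pair (x := fun e e' => cou e * (phi (e, e') * j e' b')));
  last exact: null1.
rewrite ssum_exchange; last exact: null1.
rewrite -[RHS](ssum0 k E); apply: eq_ssum => e'.
transitivity (ssum (fun e => cou e * phi (e, e')) * j e' b').
  rewrite -ssumZr; first by apply: eq_ssum => e; ring.
  exact/null_mulr/null_mulr.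
by rewrite -[ssum _]/(evl cou phi e') phi2 mul0r.
Qed.

Definition rescaled_exponent p : K := hshift 2 (app (tmor j j) phi p).

Lemma app_phiE : app (tmor j j) phi = (fun p => hbar ^+ 2 * rescaled_exponent p).
Proof. by apply: funext => p; apply/hdvd_shift/app_phi_dvd. Qed.

Lemma null_rescaled_exponent : null rescaled_exponent.
Proof.
apply: (@nullZI _ _ 2); rewrite -app_phiE; apply: null_app_jnull.
exact: jnull_tmor.
Qed.

(** The terms of the polar series are images of those of the exponential of h times the rescaled
    exponent. The latter are null at each coordinate, so their limit in k((h)) can only be their
    [ssum]. *)
Lemma twist_rescaled : Tw = hexp2 rescaled_exponent.
Proof.
have [_ _ sumT _] := phi_polar; apply: funext => p; apply/esym.
apply: (lsum_to_unique (x := fun n => expc k n * hpow2 rescaled_exponent n p)).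
  exact/null_mulr/null_expc.
move=> n; have [A hA] := sumT n; exists A => A' /hA [r _ /(_ p)].
rewrite /toL expr0 invr1 mul1r => rE; exists (r p); rewrite -rE; congr (_ - _).
apply: eq_bigr => i _; rewrite app_phiE hpow2Z; last exact: null_rescaled_exponent.
by rewrite -(tofrac_expc char0) mulrA.
Qed.

End PartB.

Theorem lemma4p1p1 (k : fieldType) (char0 : [pchar k] =i pred0) :
  (forall (U : thopf k TopFree) (F : thopf k TopProd)
      (j : hidx F -> hidx U -> fps k) (chi : hidx U * hidx U -> fps k),
    is_quea U -> is_drinfeld_prime j -> polar_cocycle chi ->
    exists chi' : hidx F * hidx F -> fps k,
    [/\ lform TopProd chi',
        forall a b, bev chi (app j a) (app j b) = hbar ^+ 2 * bev chi' a b,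
        forall a b, lsum_to (polar_terms chi (app j a) (app j b))
                      (tofrac (bev (convexp chi') a b)) &
        two_cocycle (convexp chi')])
  /\
  (forall (F : thopf k TopProd) (U : thopf k TopFree)
      (j : hidx F -> hidx U -> fps k) (phi : hidx F * hidx F -> fps k)
      (Tw : hidx U * hidx U -> fps k),
    is_qfsha F -> is_drinfeld_vee j -> polar_twist j phi Tw ->
    exists phiv : hidx U * hidx U -> fps k,
    [/\ null phiv,
        app (tmor j j) phi = (fun p => hbar ^+ 2 * phiv p),
        Tw = hexp2 phiv &
        twist (hexp2 phiv)]).
Proof.
split=> [U F j chi _ Fprime polar|F U j phi Tw _ Uvee polar].
  exists (rescaled_form j chi); split.
  - exact: null_rescaled.
  - exact: bev_chi.
  - exact: polar_terms_sum.
  exact: convexp_rescaled_cocycle.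
exists (rescaled_exponent j phi); have TwE := twist_rescaled char0 Uvee polar.
split=> //.
- exact: null_rescaled_exponent Uvee polar.
- exact: app_phiE Uvee polar.
by rewrite -TwE; case: polar.
Qed.
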